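(* Let $\mathfrak g$ be a $2$-step solvable unimodular Lie algebra endowed with a complex structure $J$. If there exist an SKT metric and a balanced metric on $\mathfrak g$, both compatible with $J$, then $J$ is solvable. In particular, there exists also a Kähler metric on $\mathfrak g$ compatible with $J$.
   Context: All Lie algebras are finite-dimensional and real. A complex structure on $\mathfrak g$ is $J\in\mathrm{End}(\mathfrak g)$ with $J^2=-\mathrm{Id}$ and $[X,Y]+J[JX,Y]+J[X,JY]-[JX,JY]=0$ for all $X,Y$. $2$-step solvable means $[\mathfrak g',\mathfrak g']=0$ with $\mathfrak g'=[\mathfrak g,\mathfrak g]$; unimodular means $\mathrm{tr}(\mathrm{ad}_X)=0$ for all $X\in\mathfrak g$. $J$ is solvable if the series $\mathfrak g^{[0]}(J)=\mathfrak g$, $\mathfrak g^{[j+1]}(J)=[\mathfrak g^{[j]}(J),\mathfrak g^{[j]}(J)]+J[\mathfrak g^{[j]}(J),\mathfrak g^{[j]}(J)]$ reaches $0$. Metrics are on the Lie algebra: a Hermitian metric compatible with $J$ is an inner product $g$ on $\mathfrak g$ with $g(J\cdot,J\cdot)=g(\cdot,\cdot)$; its fundamental form is $\omega=g(J\cdot,\cdot)$. Let $d$ be the Chevalley–Eilenberg differential on $\Lambda^\bullet\mathfrak g^*$, $d^c=J^{-1}dJ$ (with $J$ acting on forms), and $2n=\dim_{\mathbb R}\mathfrak g$. The metric is SKT if $dd^c\omega=0$, balanced if $d\omega^{n-1}=0$, and Kähler if $d\omega=0$. *)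

(* Defs.v *)
From HB Require Import structures.
From mathcomp Require Import all_boot all_order all_algebra all_fingroup.
From mathcomp Require Import sesquilinear reals.

Set Implicit Arguments.
Unset Strict Implicit.
Unset Printing Implicit Defensive.

Import Order.TTheory GRing.Theory Num.Theory.
Local Open Scope ring_scope.

Section LieAlgebra.
Context {R : realType} {g : vectType R}.
Implicit Types (br : {bilinear g -> g -> g}) (J : 'End(g)).
Implicit Types (U V W : {vspace g}).

Definition lie_bracket br : Prop :=
  (forall x, br x x = 0) /\
  (forall x y z, br x (br y z) + br y (br z x) + br z (br x y) = 0).

(* The span of all [u, v], u in U and v in V, given by bases as for prodv;
   see bracketvP. *)
Definition bracketv br U V : {vspace g} :=
  <<[seq br u v | u <- vbasis U, v <- vbasis V]>>%VS.

Lemma bracketvP br U V W :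
  reflect (forall u v, u \in U -> v \in V -> br u v \in W)
          (bracketv br U V <= W)%VS.
Proof.
apply: (iffP span_subvP) => [sW u v uU vV | sW w].
  rewrite (coord_vbasis uU) (coord_vbasis vV) linear_sumlz.
  apply: memv_suml => i _; rewrite linearZl_LR memvZ //= linear_sumr.
  apply: memv_suml => j _; rewrite linearZr_LR memvZ //.
  by apply/sW/allpairs_f; rewrite mem_nth // size_tuple.
by case/allpairsP=> -[u v] [/vbasis_mem uU /vbasis_mem vV ->]; apply: sW.
Qed.

Definition derived_alg br : {vspace g} := bracketv br fullv fullv.

Definition two_step_solvable br : Prop :=
  bracketv br (derived_alg br) (derived_alg br) = 0%VS.

Definition lfun_trace (f : 'End(g)) : R :=
  \tr (passmx.mxof (vbasis {:g}) (vbasis {:g}) f).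

Definition ad br (x : g) : 'End(g) := linfun (br x).

Definition unimodular br : Prop := forall x, lfun_trace (ad br x) = 0.

Definition complex_structure br J : Prop :=
  (forall x, J (J x) = - x) /\
  (forall x y, br x y + J (br (J x) y) + J (br x (J y)) - br (J x) (J y) = 0).

Fixpoint J_derived br J (j : nat) : {vspace g} :=
  if j is j'.+1 then
    let W := bracketv br (J_derived br J j') (J_derived br J j') in
    (W + J @: W)%VS
  else fullv.

Definition J_solvable br J : Prop := exists j, J_derived br J j = 0%VS.

(* A k-form is represented by its underlying function on k-tuples of vectors;
   the operations below are the usual ones on alternating multilinear forms. *)
Definition kform k := g ^ k -> R.

(* (d a)(x_0, ..., x_k) =
     \sum_(i < j) (-1)^(i+j) a([x_i, x_j], x_0, .., ^x_i, .., ^x_j, .., x_k);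
   for i < j, m |-> bump j (bump i m) enumerates the indices other than i, j. *)
Definition ce_args br k (x : g ^ k.+1) (i j : 'I_k.+1) : g ^ k :=
  [ffun m : 'I_k => if m == 0%N :> nat then br (x i) (x j)
                    else x (inord (bump j (bump i m.-1)))].

Definition ce_diff br k (a : kform k) : kform k.+1 := fun x =>
  \sum_(i < k.+1) \sum_(j < k.+1 | (i < j)%N)
    (-1) ^+ (i + j) * a (ce_args br x i j).

Definition wedge p q (a : kform p) (b : kform q) : kform (p + q) := fun x =>
  (p`! * q`!)%:R^-1 *
  \sum_(s : 'S_(p + q))
    (-1) ^+ s * (a [ffun i => x (s (lshift q i))] *
                 b [ffun i => x (s (rshift p i))]).

Fixpoint wedge_pow (a : kform 2) (k : nat) : kform k.*2 :=
  match k return kform k.*2 with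
  | 0 => fun _ => 1
  | k'.+1 => wedge a (@wedge_pow a k')
  end.
#[global] Arguments wedge_pow a k _ : clear implicits.

Definition form_pull (f : 'End(g)) k (a : kform k) : kform k := fun x =>
  a [ffun i => f (x i)].

(* J acts on forms by (J a)(x_1, ..., x_k) = a(J x_1, ..., J x_k); the other
   usual convention, (-1)^k times this one, only changes the sign of d^c. *)
Definition dc br J k (a : kform k) : kform k.+1 :=
  form_pull (J^-1)%VF (ce_diff br (form_pull J a)).

Implicit Type h : {dot g for idfun}.

Definition J_compatible J h : Prop := forall x y, h (J x) (J y) = h x y.

Definition fund_form J h : kform 2 := fun x => h (J (x ord0)) (x ord_max).

Definition skt br J h : Prop :=
  forall x, ce_diff br (dc br J (fund_form J h)) x = 0.

(* dim g = 2n is even as soon as g has a complex structure; if dim g = 0, the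
   power n.-1 is 0 and the condition is trivially true. *)
Definition balanced br J h : Prop :=
  let n := (\dim {:g})./2 in
  forall x, ce_diff br (wedge_pow (fund_form J h) n.-1) x = 0.

Definition kahler br J h : Prop :=
  forall x, ce_diff br (fund_form J h) x = 0.

End LieAlgebra.

(* Main.v *)
(* Put a = [g, g], aJ = (a meet Ja) and b = a + Ja, and let c and s be the brackets
   c(x, y) = [x, y] - [Jx, Jy] and s(x, y) = [x, y] + J[Jx, y].  The SKT
   condition at (x, Jx, y, Jy) says that |c(x, y)|^2 + |s(x, y)|^2 + |s(y, x)|^2
   is cancelled by terms which are linear in brackets of brackets; the balanced
   condition, for a unimodular algebra, says that the sum of s(e_i, e_i) over an
   orthonormal basis e of the balanced metric vanishes.  The balanced metric
   enters only through this sum.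

   The SKT identity first shows that, for z in a, ad(Jz) maps a into aJ after
   finitely many steps and is skew on aJ.  Then ad(Jz) vanishes on aJ, by
   induction on dim a: otherwise its image F on aJ is an ideal with a J-stable
   complementary subalgebra G, the generalized kernel of ad(Jz), and g = G + F
   with F made central is again SKT and balanced, with a smaller derived algebra;
   there the induction hypothesis makes the derived algebra J-stable, hence also
   a itself, and then [Jz, aJ] lies in [a, a] = 0.

   Finally, if ad(Ja) vanishes on aJ, summing the SKT identity over e, and over
   orthonormal bases of suitable subspaces, gives s = 0 on b and the adjunction
   h(c(y, x), x') = - h(x, s(y, x')) there.  So M = sum_i c(e_i, s(e_i, .)) is
   seminegative on b, and g is the sum of ker M, which is J-stable and abelian,
   and of im M, which is a; moreover g acts on a by skew endomorphisms commuting
   with J.  Hence Ja = a, so that J is solvable, and the metric which is h on each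
   summand and makes them orthogonal is Kahler. *)

Require Import Defs.
From HB Require Import structures.
From mathcomp Require Import all_boot all_order all_algebra all_fingroup.
From mathcomp Require Import sesquilinear reals.
From mathcomp Require Import boolp ring lra zify.

Set Implicit Arguments.
Unset Strict Implicit.
Unset Printing Implicit Defensive.

Import Order.TTheory GRing.Theory Num.Theory.
Local Open Scope ring_scope.

(** * Linear algebra *)

Section Bilinear.
Context {R : nzRingType} {U V W : lmodType R} (f : U -> V -> W).

Definition bilin : Prop :=
  (forall a x y z, f (a *: x + y) z = a *: f x z + f y z) /\
  (forall a x y z, f z (a *: x + y) = a *: f z x + f z y).

Hypothesis fB : bilin.

Lemma bil0l z : f 0 z = 0.
Proof. by have := fB.1 (-1) 0 0 z; rewrite scaler0 addr0 scaleN1r addNr. Qed.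
Lemma bil0r z : f z 0 = 0.
Proof. by have := fB.2 (-1) 0 0 z; rewrite scaler0 addr0 scaleN1r addNr. Qed.
Lemma bilDl x y z : f (x + y) z = f x z + f y z.
Proof. by have := fB.1 1 x y z; rewrite !scale1r. Qed.
Lemma bilDr x y z : f z (x + y) = f z x + f z y.
Proof. by have := fB.2 1 x y z; rewrite !scale1r. Qed.
Lemma bilZl a x z : f (a *: x) z = a *: f x z.
Proof. by have := fB.1 a x 0 z; rewrite bil0l !addr0. Qed.
Lemma bilZr a x z : f z (a *: x) = a *: f z x.
Proof. by have := fB.2 a x 0 z; rewrite bil0r !addr0. Qed.
Lemma bilNl x z : f (- x) z = - f x z.
Proof. by rewrite -scaleN1r bilZl scaleN1r. Qed.
Lemma bilNr x z : f z (- x) = - f z x.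
Proof. by rewrite -scaleN1r bilZr scaleN1r. Qed.
Lemma bilBl x y z : f (x - y) z = f x z - f y z.
Proof. by rewrite bilDl bilNl. Qed.
Lemma bilBr x y z : f z (x - y) = f z x - f z y.
Proof. by rewrite bilDr bilNr. Qed.
Lemma bil_suml (I : Type) (r : seq I) (P : pred I) (F : I -> U) z :
  f (\sum_(i <- r | P i) F i) z = \sum_(i <- r | P i) f (F i) z.
Proof. by elim/big_rec2: _ => [|i y1 y2 _ <-]; rewrite ?bil0l ?bilDl. Qed.
Lemma bil_sumr (I : Type) (r : seq I) (P : pred I) (F : I -> V) z :
  f z (\sum_(i <- r | P i) F i) = \sum_(i <- r | P i) f z (F i).
Proof. by elim/big_rec2: _ => [|i y1 y2 _ <-]; rewrite ?bil0r ?bilDr. Qed.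

End Bilinear.

Section LinearAlgebra.
Context {R : rcfType} {V : vectType R}.
Implicit Types (U W : {vspace V}) (f : 'End(V)).

(** Reduces linear identities between vectors to identities in [R], where [ring] and [lra] apply;
    the test functions that matter are the coordinates. *)
Lemma vec_ext (x y : V) :
  (forall f : V -> R, (forall u v, f (u + v) = f u + f v) ->
     (forall u, f (- u) = - f u) -> (forall k u, f (k *: u) = k * f u) ->
     f 0 = 0 -> f x = f y) -> x = y.
Proof.
move=> fE; rewrite (coord_vbasis (memvf x)) (coord_vbasis (memvf y)).
apply: eq_bigr => i _; congr (_ *: _).
apply: (fE (coord (vbasis {:V}) i)) => *; first exact: linearD.
- exact: linearN.
- exact: linearZ.
- exact: linear0.
Qed.

(** A subspace of maximal dimension inside [P] contains every vector of [P], because adjoining such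
    a vector does not leave [P]. *)
Lemma vspace_of_pred (P : V -> Prop) :
  P 0 -> (forall a x y, P x -> P y -> P (a *: x + y)) ->
  exists W, forall x, x \in W <-> P x.
Proof.
move=> P0 PD.
pose Q n := `[< exists W, (forall x, x \in W -> P x) /\ \dim W = n >].
have Qex : exists n, Q n.
  exists 0%N; apply/asboolP; exists 0%VS; split; last exact: dimv0.
  by move=> x; rewrite memv0 => /eqP->.
have Qle n : Q n -> (n <= \dim {:V})%N.
  by case/asboolP=> W [_ <-]; rewrite dimvS ?subvf.
case: (ex_maxnP Qex Qle) => n /asboolP[W [WP dW]] maxn.
exists W => x; split; first exact: WP.
move=> Px; have W'P y : y \in (W + <[x]>)%VS -> P y.
  case/memv_addP=> w /WP Pw [_ /vlineP[k ->] ->].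
  by rewrite addrC; apply: PD.
have /maxn : Q (\dim (W + <[x]>)) by apply/asboolP; exists (W + <[x]>)%VS.
move=> le; have/eqP -> : W == (W + <[x]>)%VS.
  by rewrite eqEdim addvSl dW.
by apply: (subvP (addvSr _ _)); rewrite memv_line.
Qed.

Lemma lfun_of (F : V -> V) : (forall a x y, F (a *: x + y) = a *: F x + F y) ->
  exists f : 'End(V), forall x, f x = F x.
Proof.
move=> lin; pose L : {linear V -> V} :=
  HB.pack F (GRing.isLinear.Build R V V *:%R F lin).
by exists (linfun L) => x; apply: (lfunE L x).
Qed.

Lemma lfun_inj_surj f U : (f @: U <= U)%VS ->
  (forall x, x \in U -> f x = 0 -> x = 0) ->
  forall y, y \in U -> exists2 x, x \in U & f x = y.
Proof.
move=> fU injf y yU; suff : y \in (f @: U)%VS by case/memv_imgP=> x xU ->; exists x.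
have/eqP -> // : (f @: U)%VS == U.
have UK : (U :&: lker f = 0)%VS.
  apply/eqP; rewrite -subv0; apply/subvP => x.
  by rewrite memv_cap memv_ker memv0 => /andP[xU /eqP fx]; rewrite (injf x).
by rewrite eqEdim fU (limg_dim_eq UK) /=.
Qed.

Definition inner (h : V -> V -> R) : Prop :=
  [/\ forall a x y z, h (a *: x + y) z = a * h x z + h y z,
      forall x y, h x y = h y x & forall x, x != 0 -> 0 < h x x].

Section Inner.
Context (h : V -> V -> R) (hI : inner h).

Lemma innC x y : h x y = h y x. Proof. by case: hI. Qed.
Lemma inn_bil : bilin (h : V -> V -> R^o).
Proof.
case: hI => hl hs _; split=> [|a x y z]; first exact: hl.
by rewrite hs hl !(hs z).
Qed.
Lemma inn0l z : h 0 z = 0. Proof. exact: (bil0l inn_bil). Qed.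
Lemma inn0r z : h z 0 = 0. Proof. exact: (bil0r inn_bil). Qed.
Lemma innDl x y z : h (x + y) z = h x z + h y z. Proof. exact: (bilDl inn_bil). Qed.
Lemma innDr x y z : h z (x + y) = h z x + h z y. Proof. exact: (bilDr inn_bil). Qed.
Lemma innNl x z : h (- x) z = - h x z. Proof. exact: (bilNl inn_bil). Qed.
Lemma innNr x z : h z (- x) = - h z x. Proof. exact: (bilNr inn_bil). Qed.
Lemma innBl x y z : h (x - y) z = h x z - h y z. Proof. exact: (bilBl inn_bil). Qed.
Lemma innBr x y z : h z (x - y) = h z x - h z y. Proof. exact: (bilBr inn_bil). Qed.
Lemma innZl a x z : h (a *: x) z = a * h x z. Proof. exact: (bilZl inn_bil). Qed.
Lemma innZr a x z : h z (a *: x) = a * h z x. Proof. exact: (bilZr inn_bil). Qed.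
Lemma inn_suml (I : Type) (r : seq I) (P : pred I) (F : I -> V) z :
  h (\sum_(i <- r | P i) F i) z = \sum_(i <- r | P i) h (F i) z.
Proof. exact: (bil_suml inn_bil). Qed.
Lemma inn_sumr (I : Type) (r : seq I) (P : pred I) (F : I -> V) z :
  h z (\sum_(i <- r | P i) F i) = \sum_(i <- r | P i) h z (F i).
Proof. exact: (bil_sumr inn_bil). Qed.

Lemma inn_ge0 x : 0 <= h x x.
Proof.
by case: (eqVneq x 0) => [->|/(let: And3 _ _ p := hI in p)/ltW //]; rewrite inn0l.
Qed.
Lemma inn_eq0 x : h x x = 0 -> x = 0.
Proof.
move=> hx; apply: contra_eq hx => /(let: And3 _ _ p := hI in p) hx.
by rewrite gt_eqF.
Qed.

Lemma inn_fun_lin z : linear_for *%R (h^~ z : V -> R).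
Proof. by move=> a x y; case: hI => ->. Qed.

(** The factor [v] turns the functional [h^~ v] into an endomorphism, so that its kernel is an
    [lker]. *)
Definition perp (v : V) : {vspace V} :=
  lker (linfun (fun x => h x v *: v)).

Lemma perpP v x : v != 0 -> (x \in perp v) = (h x v == 0).
Proof.
move=> v0; have lin : linear (fun x => h x v *: v).
  by move=> a y z; rewrite inn_fun_lin scalerDl scalerA.
pose L : {linear V -> V} :=
  HB.pack (fun x => h x v *: v) (GRing.isLinear.Build R V V *:%R _ lin).
rewrite /perp memv_ker (_ : linfun _ x = L x) ?scaler_eq0 ?(negPf v0) ?orbF //.
exact: (lfunE L x).
Qed.

Record onb n (X : 'I_n -> V) U : Prop := Onb {
  onb_mem : forall i, X i \in U;
  onb_dot : forall i j, h (X i) (X j) = (i == j)%:R;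
  onb_exp : forall u, u \in U -> u = \sum_i h u (X i) *: X i }.

Lemma unit_vector U : U != 0%VS -> exists2 v, v \in U & h v v = 1.
Proof.
rewrite -vpick0 => p0; have hp : 0 < h (vpick U) (vpick U).
  by case: hI => _ _; apply.
exists ((Num.sqrt (h (vpick U) (vpick U)))^-1 *: vpick U).
  by rewrite memvZ ?memv_pick.
rewrite innZl innZr mulrA -invfM -expr2 sqr_sqrtr ?inn_ge0 // mulVf //.
by rewrite gt_eqF.
Qed.

(** Gram-Schmidt: a unit vector [v] is split off, and the induction continues in its orthogonal
    complement inside [U]. *)
Lemma onb_exists U : exists n, exists X : 'I_n -> V, onb X U.
Proof.
move: {2}(\dim U).+1 (ltnSn (\dim U)) => n; elim: n U => // n IH U.
rewrite ltnS => dU; case: (eqVneq U 0%VS) => [->|U0].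
  exists 0%N, (fun=> 0); split; [by move=> i; have := ltn_ord i|by move=> i; have := ltn_ord i|].
  by move=> u; rewrite memv0 big_ord0 => /eqP.
have [v vU hv] := unit_vector U0.
have v0 : v != 0 by apply/eqP => v0; move: hv; rewrite v0 inn0l => /eqP; rewrite eq_sym oner_eq0.
have vNp : v \notin perp v by rewrite perpP // hv oner_eq0.
pose U' := (U :&: perp v)%VS.
have dU' : (\dim U' < n)%N.
  apply: leq_trans dU; rewrite ltn_neqAle dimvS ?capvSl // andbT.
  apply: contra vNp => /eqP dE.
  have /eqP UE : U' == U by rewrite eqEdim dE leqnn andbT capvSl.
  by move: vU; rewrite -UE memv_cap => /andP[].
have [m [X [Xm Xd Xe]]] := IH _ dU'.
have Xp j : h (X j) v = 0.
  by have := Xm j; rewrite memv_cap perpP // => /andP[_ /eqP].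
exists m.+1, (fun i => oapp X v (unlift ord0 i)); split.
- by move=> i; case: unliftP => [j|] _ //=; have := Xm j; rewrite memv_cap => /andP[].
- move=> i j; case: unliftP => [i' ->|->]; case: unliftP => [j' ->|->] /=.
  + by rewrite Xd (inj_eq lift_inj).
  + by rewrite Xp.
  + by rewrite innC Xp.
  + by rewrite hv.
move=> u uU; rewrite big_ord_recl unlift_none /=.
under eq_bigr => i _ do rewrite liftK /=.
pose u' := u - h u v *: v.
have u'U : u' \in U'.
  rewrite memv_cap perpP // rpredB ?memvZ //=.
  by rewrite innBl innZl hv mulr1 subrr.
have uE : u = h u v *: v + u' by rewrite addrCA subrr addr0.
rewrite {1}uE; congr (_ + _); rewrite {1}(Xe _ u'U); apply: eq_bigr => i _.
by rewrite innBl innZl (innC v) Xp mulr0 subr0.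
Qed.

Section Onb.
Context n (X : 'I_n -> V) U (oX : onb X U).

Lemma parseval u v : u \in U -> h u v = \sum_i h u (X i) * h (X i) v.
Proof.
move=> uU; rewrite {1}(onb_exp oX uU) inn_suml.
by apply: eq_bigr => i _; rewrite innZl.
Qed.

Lemma onb_ind (P : V -> Prop) : P 0 ->
  (forall k x y, P x -> P y -> P (k *: x + y)) -> (forall i, P (X i)) ->
  forall u, u \in U -> P u.
Proof.
move=> P0 PD PX u uU; rewrite (onb_exp oX uU).
elim/big_rec: _ => // i y _ Py; exact: PD.
Qed.

Definition oproj (x : V) := \sum_i h x (X i) *: X i.

Lemma oproj_mem x : oproj x \in U.
Proof. by apply: memv_suml => i _; rewrite memvZ ?(onb_mem oX). Qed.
Lemma oproj_perp x u : u \in U -> h (x - oproj x) u = 0.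
Proof.
move=> uU; rewrite innBl (innC x) (parseval _ uU) /oproj inn_suml.
rewrite -sumrB big1 // => i _.
by rewrite innZl (innC _ x) mulrC (innC (X i) u) subrr.
Qed.

(* The matrix of a map L with entries L_kl satisfies
   |A|^2 + |L|^2 + 2 tr (A L) = |A + L^T|^2. *)
Lemma trace_square (A L : V -> V) :
  (forall a x y, A (a *: x + y) = a *: A x + A y) ->
  (forall l, A (X l) \in U) -> (forall l, L (X l) \in U) ->
  \sum_l (h (A (X l)) (A (X l)) + h (L (X l)) (L (X l))
          + 2 * h (A (L (X l))) (X l)) =
  \sum_l \sum_k (h (A (X k)) (X l) + h (L (X l)) (X k)) ^+ 2.
Proof.
move=> Al AU LU.
have A0 : A 0 = 0.
  by have := Al (-1) 0 0; rewrite scaler0 addr0 scaleN1r addNr.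
have Asum (F : 'I_n -> R) : A (\sum_k F k *: X k) = \sum_k F k *: A (X k).
  by elim/big_rec2: _ => // i y1 y2 _ <-; rewrite Al.
rewrite !big_split /= (eq_bigr (fun l => \sum_k h (A (X l)) (X k) ^+ 2)); last first.
  by move=> l _; rewrite parseval //; apply: eq_bigr => k _; rewrite expr2 (innC (X k)).
rewrite exchange_big /= -2!big_split /=; apply: eq_bigr => l _.
have -> : h (A (L (X l))) (X l) =
    \sum_k h (L (X l)) (X k) * h (A (X k)) (X l).
  rewrite {1}(onb_exp oX (LU l)) Asum inn_suml.
  by apply: eq_bigr => k _; rewrite innZl.
rewrite (parseval _ (LU l)) mulr_sumr -2!big_split /=.
by apply: eq_bigr => k _; rewrite (innC (X k)); ring.
Qed.

End Onb.
End Inner.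
End LinearAlgebra.

(** * The brackets c and s *)

(* For X = x - iJx and Y = y - iJy in g^{1,0}, cb and sb encode twice the
   brackets [X, Y] and the (1,0)-part of [conj X, Y] respectively, where a
   vector v of g stands for v - iJv. *)
HB.lock Definition cb (R : rcfType) (g : vectType R) (br : g -> g -> g)
  (J : 'End(g)) (x y : g) : g := br x y - br (J x) (J y).
HB.lock Definition sb (R : rcfType) (g : vectType R) (br : g -> g -> g)
  (J : 'End(g)) (x y : g) : g := br x y + J (br (J x) y).

Section ComplexLie.
Context {R : rcfType} {g : vectType R}.
Implicit Types (x y z w : g) (U W : {vspace g}).

Record complex_lie (br : g -> g -> g) (J : 'End(g)) : Prop := ComplexLie {
  cl_bilin : bilin br;
  cl_alt : forall x, br x x = 0;
  cl_jac : forall x y z, br x (br y z) + br y (br z x) + br z (br x y) = 0;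
  cl_meta : forall x y z w, br (br x y) (br z w) = 0;
  cl_JJ : forall x, J (J x) = - x;
  cl_nij : forall x y,
    br x y + J (br (J x) y) + J (br x (J y)) - br (J x) (J y) = 0 }.

Context (br : g -> g -> g) (J : 'End(g)) (CL : complex_lie br J).
Local Notation c := (cb br J).
Local Notation s := (sb br J).
Let B := cl_bilin CL.
Let JJ := cl_JJ CL.

Let JD x y : J (x + y) = J x + J y. Proof. exact: linearD. Qed.
Let JN x : J (- x) = - J x. Proof. exact: linearN. Qed.

Lemma brC x y : br x y = - br y x.
Proof.
have := cl_alt CL (x + y).
rewrite (bilDl B) !(bilDr B) !(cl_alt CL) add0r addr0 => /eqP.
by rewrite addr_eq0 => /eqP.
Qed.

Lemma br_der x y z : br x (br y z) = br (br x y) z + br y (br x z).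
Proof.
have := cl_jac CL x y z; rewrite (brC z (br x y)) (brC z x) (bilNr B) => /eqP.
by rewrite subr_eq0 -(subr0 (br x (br y z) - _)) subr0 subr_eq addrC => /eqP.
Qed.

Lemma J_inj x y : J x = J y -> x = y.
Proof. by move=> /(congr1 J); rewrite !JJ => /oppr_inj. Qed.

Lemma brJJ x y : br (J x) (J y) = br x y + J (br (J x) y) + J (br x (J y)).
Proof. by apply/esym/eqP; rewrite -subr_eq0 (cl_nij CL). Qed.

Lemma cb_bilin : bilin c.
Proof.
split=> a x y z; rewrite cb.unlock linearP (B.1, B.2) (B.1, B.2);
  by apply: vec_ext => f fD fN fZ f0; rewrite !(fD, fN, fZ) /=; ring.
Qed.
Lemma sb_bilin : bilin s.
Proof.
split=> a x y z; rewrite sb.unlock ?linearP !(B.1, B.2) !linearP;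
  by apply: vec_ext => f fD fN fZ f0; rewrite !(fD, fZ) /=; ring.
Qed.
Let cB := cb_bilin.
Let sB := sb_bilin.

Lemma cbC x y : c x y = - c y x.
Proof. by rewrite cb.unlock (brC x) (brC (J x)) opprB opprK addrC. Qed.
Lemma cbJl x y : c (J x) y = J (c x y).
Proof.
rewrite cb.unlock JJ (bilNl B) brJJ opprK !(JD, JN, JJ); apply: vec_ext => f fD fN fZ f0.
by rewrite !(fD, fN) /=; ring.
Qed.
Lemma cbJr x y : c x (J y) = J (c x y).
Proof. by rewrite cbC cbJl -JN -cbC. Qed.
Lemma sbJl x y : s (J x) y = - J (s x y).
Proof. by rewrite sb.unlock JJ (bilNl B) !(JD, JN, JJ) opprD opprK addrC. Qed.
Lemma sbJr x y : s x (J y) = J (s x y).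
Proof.
rewrite sb.unlock brJJ !(JD, JN, JJ); apply: vec_ext => f fD fN fZ f0.
by rewrite !(fD, fN) /=; ring.
Qed.

Lemma brE x y : br x y *+ 2 = c x y + s x y - s y x.
Proof.
rewrite cb.unlock sb.unlock (brC y x) (brC (J y) x) brJJ; apply: vec_ext => f fD fN fZ f0.
by rewrite !mulr2n !(JD, JN, JJ, fD, fN) /=; lra.
Qed.

(* The components of the Jacobi identity of given type (C-linear or
   C-antilinear in each of the three arguments): they are separated by
   substituting J into the arguments. *)
Let jac_lll x y z := c x (c y z) + c y (c z x) + c z (c x y).
Let jac_lla x y z :=
  c y (s z x) - c x (s z y) + s z (c x y) + s (s x z) y - s (s y z) x.
Let jac_aal x y z := s x (s y z) - s y (s x z) - s (c x y) z.

Let jac4 x y z : jac_lll x y z +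
  (jac_lla x y z + jac_lla y z x + jac_lla z x y) +
  (jac_aal x y z + jac_aal y z x + jac_aal z x y) = 0.
Proof.
have E u v w : br u (br v w) *+ 4 =
    c u (c v w) + c u (s v w) - c u (s w v)
     + (s u (c v w) + s u (s v w) - s u (s w v))
     - (s (c v w) u + s (s v w) u - s (s w v) u).
  have -> : br u (br v w) *+ 4 = br u (br v w *+ 2) *+ 2.
    by rewrite (mulrnA _ 2 2) (mulr2n (br v w)) (bilDr B) -mulr2n.
  by rewrite !brE !(bilBr cB, bilDr cB, bilBr sB, bilDr sB, bilBl sB, bilDl sB).
have : (br x (br y z) + br y (br z x) + br z (br x y)) *+ 4 = 0.
  by rewrite (cl_jac CL) mul0rn.
rewrite 2!mulrnDl !E => <-; apply: vec_ext => f fD fN fZ f0.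
by rewrite /jac_lll /jac_lla /jac_aal !(fD, fN); ring.
Qed.

Let lllJ x y z : (jac_lll (J x) y z = J (jac_lll x y z)) *
  (jac_lll x (J y) z = J (jac_lll x y z)) * (jac_lll x y (J z) = J (jac_lll x y z)).
Proof. by rewrite /jac_lll !(cbJl, cbJr) !JD. Qed.
Let llaJ x y z : (jac_lla (J x) y z = J (jac_lla x y z)) *
  (jac_lla x (J y) z = J (jac_lla x y z)) * (jac_lla x y (J z) = - J (jac_lla x y z)).
Proof.
rewrite /jac_lla !(cbJl, cbJr, sbJl, sbJr, bilNl sB, bilNr cB, bilNr sB, JD, JN).
by rewrite !(sbJl, cbJr, opprK, JN, bilNl sB, opprD).
Qed.
Let aalJ x y z : (jac_aal (J x) y z = - J (jac_aal x y z)) *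
  (jac_aal x (J y) z = - J (jac_aal x y z)) * (jac_aal x y (J z) = J (jac_aal x y z)).
Proof.
rewrite /jac_aal !(cbJl, cbJr, sbJl, sbJr, bilNl sB, bilNr cB, bilNr sB, JD, JN).
by rewrite !(opprK, JN, bilNl sB, opprD).
Qed.

Let jac_split x y z : (jac_lla x y z = 0) * (jac_aal x y z = 0).
Proof.
have J0 u : J u = 0 -> u = 0 by move=> Ju; apply: J_inj; rewrite Ju linear0.
(* Putting J into an argument multiplies each component by J or -J, according to its type. The eight
   substitutions thus give a linear system in the seven components. *)
have e1 := jac4 x y z; have e2 := jac4 (J x) y z; have e3 := jac4 x (J y) z.
have e4 := jac4 x y (J z); have e5 := jac4 (J x) (J y) z.
have e6 := jac4 (J x) y (J z); have e7 := jac4 x (J y) (J z).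
have e8 := jac4 (J x) (J y) (J z).
rewrite !(lllJ, llaJ, aalJ) ?JN -?(JN, JD) in e2 e3 e4.
rewrite !(lllJ, llaJ, aalJ) ?JN ?opprK ?JJ in e5 e6 e7.
rewrite !(lllJ, llaJ, aalJ) ?(JN, opprK, JJ) -?JN -?JD in e8.
move/J0: e2 e3 e4 e8 => e2 /J0 e3 /J0 e4 /J0 e8; move: e1 e2 e3 e4 e5 e6 e7 e8.
move: (jac_lll x y z) (jac_lla x y z) (jac_lla y z x) (jac_lla z x y).
move: (jac_aal x y z) (jac_aal y z x) (jac_aal z x y) => d1 d2 d3 a b1 b2 b3.
move=> e1 e2 e3 e4 e5 e6 e7 e8.
split; apply: vec_ext => f fD fN fZ f0; rewrite f0.
  move: (congr1 f e1) (congr1 f e2) (congr1 f e3) (congr1 f e4) (congr1 f e5)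
    (congr1 f e6) (congr1 f e7) (congr1 f e8).
  rewrite !(fD, fN, f0).
  move: (f a) (f b1) (f b2) (f b3) (f d1) (f d2) (f d3).
  by move=> {e1 e2 e3 e4 e5 e6 e7 e8} *; lra.
move: (congr1 f e1) (congr1 f e2) (congr1 f e3) (congr1 f e4) (congr1 f e5)
  (congr1 f e6) (congr1 f e7) (congr1 f e8).
rewrite !(fD, fN, f0).
move: (f a) (f b1) (f b2) (f b3) (f d1) (f d2) (f d3).
by move=> {e1 e2 e3 e4 e5 e6 e7 e8} *; lra.
Qed.

(** This is the Bott representation: g^{0,1} acts by brackets on the quotient of the
    complexification by g^{0,1}, which is identified with g^{1,0}. *)
Lemma sb_flat x y z : s x (s y z) - s y (s x z) = s (c x y) z.
Proof. by apply/eqP; rewrite -subr_eq0; apply/eqP; apply: (jac_split x y z).2. Qed.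

Lemma sb_cb z x y : s z (c x y) =
  c (s z x) y + c x (s z y) - s (s x z) y + s (s y z) x.
Proof.
apply: vec_ext => f fD fN fZ f0; have := congr1 f (jac_split x y z).1.
by rewrite /jac_lla (cbC y) !(fD, fN, f0) => ?; lra.
Qed.
End ComplexLie.

(** * The derived algebra and its largest J-stable subspace *)

Section DerivedAlgebra.
Context {R : rcfType} {g : vectType R}.
Implicit Types (x y z w : g) (U W : {vspace g}).

(** Unlike [derived_alg], this accepts a bare function, because it is also applied to the modified
    bracket [red_br] below. *)
Definition lie_der (br : g -> g -> g) : {vspace g} :=
  <<[seq br u v | u <- vbasis {:g}, v <- vbasis {:g}]>>%VS.

Definition der_J br (J : 'End(g)) : {vspace g} :=
  (lie_der br :&: J @: lie_der br)%VS.

Context (br : g -> g -> g) (J : 'End(g)) (CL : complex_lie br J).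
Local Notation c := (cb br J).
Local Notation s := (sb br J).
Local Notation a := (lie_der br).
Local Notation aJ := (der_J br J).
Let B := cl_bilin CL.
Let JJ := cl_JJ CL.
Let JD x y : J (x + y) = J x + J y. Proof. exact: linearD. Qed.
Let JN x : J (- x) = - J x. Proof. exact: linearN. Qed.

Lemma lie_der_sub U : (forall x y, br x y \in U) -> (a <= U)%VS.
Proof. by move=> brU; apply/span_subvP => _ /allpairsP[[u v] [_ _ ->]]. Qed.

Lemma mem_br x y : br x y \in a.
Proof.
rewrite (coord_vbasis (memvf x)) (coord_vbasis (memvf y)) (bil_suml B).
apply: memv_suml => i _; rewrite (bilZl B) memvZ // (bil_sumr B).
apply: memv_suml => j _; rewrite (bilZr B) memvZ //.
by apply/memv_span/allpairs_f; rewrite mem_nth // size_tuple.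
Qed.

Lemma mem_der_J x : (x \in aJ) = (x \in a) && (J x \in a).
Proof.
rewrite memv_cap; congr (_ && _); apply/idP/idP => [/memv_imgP[y ya ->]|Jxa].
  by rewrite JJ memvN.
by rewrite -[x]opprK -JJ memv_img // JN memvN.
Qed.

Lemma der_J_a x : x \in aJ -> x \in a.
Proof. by rewrite mem_der_J => /andP[]. Qed.
Lemma der_JJa x : x \in aJ -> J x \in a.
Proof. by rewrite mem_der_J => /andP[]. Qed.
Lemma der_JJ x : x \in aJ -> J x \in aJ.
Proof. by rewrite !mem_der_J JJ memvN andbC. Qed.

Lemma der_ind (P : g -> Prop) : P 0 ->
  (forall k x y, P x -> P y -> P (k *: x + y)) -> (forall x y, P (br x y)) ->
  forall x, x \in a -> P x.
Proof.
move=> P0 PD Pbr x xa; have [W WP] := vspace_of_pred P0 PD.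
by apply/WP; apply: subvP xa; apply: lie_der_sub => u v; apply/WP.
Qed.

Lemma br_der0 x y : x \in a -> y \in a -> br x y = 0.
Proof.
move=> xa ya; move: x xa; apply: der_ind => [|k x z xy zy|x z].
- exact: (bil0l B).
- by rewrite (bilDl B) (bilZl B) xy zy scaler0 addr0.
move: y ya; apply: der_ind => [|k y w xy zy|y w].
- exact: (bil0r B).
- by rewrite (bilDr B) (bilZr B) xy zy scaler0 addr0.
exact: (cl_meta CL).
Qed.

(** The commutator of the two operators is ad [x, y], which kills the abelian ideal [a]. *)
Lemma ad_comm x y z : z \in a -> br x (br y z) = br y (br x z).
Proof. by move=> za; rewrite (br_der CL) (br_der0 (mem_br _ _) za) add0r. Qed.

Lemma cb_derJ x y : c x y \in aJ.
Proof.
by rewrite mem_der_J -(cbJl CL) !cb.unlock !memvB ?mem_br.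
Qed.

Lemma J_br_sub x y : x \in a -> y \in a -> br (J x) y - br (J y) x \in aJ.
Proof.
move=> xa ya; rewrite mem_der_J memvB ?mem_br //=.
suff -> : J (br (J x) y - br (J y) x) = br (J x) (J y) by rewrite mem_br.
by rewrite (brJJ CL) (br_der0 xa ya) add0r -(brC CL x) JD.
Qed.

Lemma adJ_derJ w x : w \in aJ -> x \in a -> br (J w) x = 0.
Proof. by move=> /der_JJa wa xa; exact: br_der0. Qed.

Lemma adJ_J z x : z \in a -> x \in aJ -> br (J z) (J x) = J (br (J z) x).
Proof.
move=> za xJ; rewrite (brJJ CL) (br_der0 za (der_J_a xJ)).
by rewrite (br_der0 za (der_JJa xJ)) linear0 addr0 add0r.
Qed.

Lemma adJ_mem z x : z \in a -> x \in aJ -> br (J z) x \in aJ.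
Proof. by move=> za xJ; rewrite mem_der_J mem_br -adJ_J // mem_br. Qed.

(** Modulo [aJ], z * w = [Jz, w] is a commutative associative product on [a]: [J_br_sub] gives
    commutativity, this lemma associativity, and [adJ_derJ] and [adJ_mem] make the product well
    defined on a / aJ. *)
Lemma adJ_mul z w x : z \in a -> w \in a -> x \in a ->
  br (J (br (J z) w)) x - br (J z) (br (J w) x) \in aJ.
Proof.
move=> za wa xa.
have e1 := J_br_sub (mem_br (J z) w) xa.
have := memvB e1 (adJ_mem za (J_br_sub wa xa)).
rewrite (bilBr B) (ad_comm (J z) (J x) wa) opprB addrA subrK => h1.
exact: h1.
Qed.

Lemma sb_derJ_der x w : x \in aJ -> w \in a -> s x w = 0.
Proof.
move=> xJ wa; rewrite sb.unlock (br_der0 (der_J_a xJ) wa).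
by rewrite (br_der0 (der_JJa xJ) wa) linear0 addr0.
Qed.

Lemma sb_der z x : z \in a -> x \in a -> s z x = J (br (J z) x).
Proof. by move=> za xa; rewrite sb.unlock (br_der0 za xa) add0r. Qed.

Lemma cb_derJ_der x w : x \in aJ -> w \in a -> c x w = s w x.
Proof.
move=> xJ wa; rewrite (sb_der wa (der_J_a xJ)) cb.unlock (br_der0 (der_J_a xJ) wa).
by rewrite sub0r (brC CL (J x)) opprK (adJ_J wa xJ).
Qed.

Lemma sb_self y : s y y = - J (br y (J y)).
Proof. by rewrite sb.unlock (cl_alt CL) add0r (brC CL) JN. Qed.

End DerivedAlgebra.

(** * Adjoint action of Ja on a *)

Section SKTBalanced.
Context {R : rcfType} {g : vectType R}.
Implicit Types (x y z w : g) (U W : {vspace g}).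

(* Up to a factor, the value of dd^c(omega) at (x, Jx, y, Jy). *)
Definition skt_form br (J : 'End(g)) (h : g -> g -> R) x y : R :=
  let c := cb br J in let s := sb br J in
  h (c x y) (c x y) + h (s y x) (s y x) + h (s x y) (s x y)
  + 2 * h (s x (c x y)) y - 2 * h (c (s y x) y) x + 2 * h (c (s y y) x) x
  - 2 * h (s x x) (s y y) + 2 * h (s (s x x) y) y - 2 * h (s (s y x) x) y.

(* The family e is meant to be an orthonormal basis of another Hermitian metric,
   which is balanced. *)
Record skt_balanced (br : g -> g -> g) (J : 'End(g)) (h : g -> g -> R)
    n (e : 'I_n -> g) : Prop := SKTBalanced {
  sk_cl : complex_lie br J;
  sk_inner : inner h;
  sk_compat : forall x y, h (J x) (J y) = h x y;
  sk_skt : forall x y, skt_form br J h x y = 0;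
  sk_bal : \sum_i sb br J (e i) (e i) = 0;
  sk_span : forall U, (forall i, e i \in U) -> U = fullv }.

Context (br : g -> g -> g) (J : 'End(g)) (h : g -> g -> R) (n : nat) (e : 'I_n -> g).
Hypothesis SB : skt_balanced br J h e.
Local Notation c := (cb br J).
Local Notation s := (sb br J).
Local Notation a := (lie_der br).
Local Notation aJ := (der_J br J).
Let CL := sk_cl SB.
Let hI := sk_inner SB.
Let B := cl_bilin CL.
Let sB := sb_bilin CL.
Let JJ := cl_JJ CL.
Let JN x : J (- x) = - J x. Proof. exact: linearN. Qed.

Lemma span_ind (P : g -> Prop) : P 0 ->
  (forall k x y, P x -> P y -> P (k *: x + y)) -> (forall i, P (e i)) ->
  forall x, P x.
Proof.
move=> P0 PD Pe x; have [W WP] := vspace_of_pred P0 PD.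
apply/WP; suff -> : W = fullv by rewrite memvf.
by apply: (sk_span SB) => i; apply/WP.
Qed.

(** With D = ad(Jy), this is half of the SKT identity at (x, y): for these arguments c and s are
    expressed by D and J, and s(x, .) vanishes on [a]. *)
Lemma skt_derJ x y : x \in aJ -> y \in a ->
  h (br (J y) x) (br (J y) x) + h (br (J y) (br (J y) x)) x
  + h (br (J (br (J y) y)) x) x = 0.
Proof.
move=> xJ ya; have xa := der_J_a CL xJ; have DxJ := adJ_mem CL ya xJ.
have sxw w : w \in a -> s x w = 0 by exact: (sb_derJ_der CL).
have syx : s y x = J (br (J y) x) by rewrite (sb_der CL).
have cxy : c x y = J (br (J y) x) by rewrite (cb_derJ_der CL).
have cyx : c (s y x) y = - br (J y) (br (J y) x).
  by rewrite syx (cbJl CL) (cb_derJ_der CL DxJ ya) (sb_der CL ya (der_J_a CL DxJ)) JJ.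
have cyy : c (s y y) x = br (J (br (J y) y)) x.
  have ma := mem_br CL (J y) y.
  rewrite (sb_der CL ya ya) (cbJl CL) (cbC CL) (cb_derJ_der CL xJ ma).
  by rewrite (sb_der CL ma xa) JN JJ opprK.
have := sk_skt SB x y; rewrite /skt_form cyx cyy cxy syx (sxw y ya) (sxw x xa).
rewrite !(sb_derJ_der CL (der_JJ CL DxJ)) //.
rewrite !(bil0l sB) !(inn0l hI) !(sxw _ _) ?(der_JJa CL) //.
rewrite !(inn0l hI) (innNl hI) !(sk_compat SB).
lra.
Qed.

Let adJ k y x := iter k (br (J y)) x.

Lemma iter_adJ_a k y x : x \in a -> adJ k y x \in a.
Proof. by move=> xa; case: k => //= k; rewrite (mem_br CL). Qed.

Lemma iter_adJ_derJ k y x : y \in a -> x \in aJ -> adJ k y x \in aJ.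
Proof. by move=> ya xJ; elim: k => //= k IH; apply: (adJ_mem CL). Qed.

(** In the algebra a / aJ, k multiplications by y * y are 2k multiplications by y. *)
Lemma iter_adJ_mul k y x : y \in a -> x \in a ->
  adJ k (br (J y) y) x - adJ k.*2 y x \in aJ.
Proof.
move=> ya xa; elim: k => [|k IH]; first by rewrite subrr mem0v.
have ua := iter_adJ_a k (br (J y) y) xa.
have e1 := adJ_mul CL ya ya ua.
have e2 := adJ_mem CL ya (adJ_mem CL ya IH).
rewrite !(bilBr B) in e2; have := memvD e1 e2.
by rewrite addrA subrK.
Qed.

(** Summed over an orthonormal basis of [aJ], [skt_derJ] becomes |D|^2 + tr D^2 = 0 for D = ad(Jy).
    By [trace_square], twice the left-hand side is |D + D^T|^2. *)
Lemma adJ_skew_sq y : y \in a ->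
  (forall x, x \in aJ -> h (br (J (br (J y) y)) x) x = 0) ->
  forall x x', x \in aJ -> x' \in aJ -> h (br (J y) x) x' = - h x (br (J y) x').
Proof.
move=> ya tr0; have [m [X oX]] := onb_exists hI aJ.
have XJ l : X l \in aJ by exact: onb_mem oX l.
have := @trace_square _ _ _ hI _ _ _ oX (br (J y)) (br (J y)) _ _ _.
move=> /(_ (fun k u v => B.2 k u v (J y))).
move=> /(_ (fun l => adJ_mem CL ya (XJ l)) (fun l => adJ_mem CL ya (XJ l))).
rewrite big1 => [|l _]; last first.
  by have := skt_derJ (XJ l) ya; rewrite tr0 //; lra.
move=> /esym/psumr_eq0P sq0.
have XX l k : h (br (J y) (X k)) (X l) = - h (X k) (br (J y) (X l)).
  have /psumr_eq0P := sq0 (fun i _ => sumr_ge0 _ (fun k _ => sqr_ge0 _)) l isT.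
  move=> /(_ (fun k _ => sqr_ge0 _) k isT) /eqP.
  by rewrite sqrf_eq0 addr_eq0 (innC hI (br _ (X l))) => /eqP.
move=> x x' xJ; move: x'; apply: (onb_ind oX); first by rewrite (bil0r B) !(inn0r hI) oppr0.
  by move=> k u v E1 E2; rewrite B.2 !(innDr hI) !(innZr hI) E1 E2; ring.
move=> l; move: x xJ; apply: (onb_ind oX); first by rewrite (bil0r B) !(inn0l hI) oppr0.
  by move=> k u v E1 E2; rewrite B.2 !(innDl hI) !(innZl hI) E1 E2; ring.
by move=> k; apply: XX.
Qed.

(** Strong induction on [m]: for [Jy, y], the square of y in a / aJ, the index [uphalf m] suffices,
    so ad(J[Jy, y]) is already skew on [aJ] and the hypothesis of [adJ_skew_sq] holds. If m is at
    most 1, [Jy, y] lies in [aJ] and ad(J[Jy, y]) kills [a]. *)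
Lemma adJ_skew_nil m y : y \in a -> (forall x, x \in a -> adJ m y x \in aJ) ->
  forall x x', x \in aJ -> x' \in aJ -> h (br (J y) x) x' = - h x (br (J y) x').
Proof.
elim/ltn_ind: m y => m IH y ya nil; apply: adJ_skew_sq => // x xJ.
have wa := mem_br CL (J y) y.
case: (leqP m 1) => [m1|m2].
  rewrite (adJ_derJ CL) ?(inn0l hI) ?(der_J_a CL) //.
  case: m m1 nil {IH} => [|[|//]] _ nil; first by have := nil _ wa.
  by have := nil _ ya.
suff E : h (br (J (br (J y) y)) x) x = - h x (br (J (br (J y) y)) x).
  by move: E; rewrite (innC hI x); lra.
apply: (IH (uphalf m)) => //; first by lia.
move=> u ua; have := iter_adJ_mul (uphalf m) ya ua.
rewrite -(rpredDr _ (iter_adJ_derJ ((uphalf m).*2 - m) ya (nil u ua))).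
by rewrite /adJ -iterD subnK ?subrK //; lia.
Qed.
End SKTBalanced.

(** * Nilpotency of the elements of a / aJ *)

Section Nilpotency.
Context {R : rcfType} {g : vectType R}.
Implicit Types (x y z w : g) (U W : {vspace g}).
Context (br : g -> g -> g) (J : 'End(g)) (h : g -> g -> R) (n : nat) (e : 'I_n -> g).
Hypothesis SB : skt_balanced br J h e.
Local Notation c := (cb br J).
Local Notation a := (lie_der br).
Local Notation aJ := (der_J br J).
Let CL := sk_cl SB.
Let hI := sk_inner SB.
Let B := cl_bilin CL.
Let sB := sb_bilin CL.
Let JJ := cl_JJ CL.
Let JD x y : J (x + y) = J x + J y. Proof. exact: linearD. Qed.
Let JN x : J (- x) = - J x. Proof. exact: linearN. Qed.

Lemma br_Jl_sub x y : x \in a ->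
  br (J x) y - br (J y) x \in aJ /\ br (J x) (J y) + br y x \in aJ.
Proof.
move=> xa; have E : br (J x) (J y) + br y x = J (br (J x) y - br (J y) x).
  rewrite (brJJ CL) (brC CL x (J y)) (brC CL x y) !(JD, JN).
  by apply: vec_ext => f fD fN _ _; rewrite !(fD, fN); ring.
have m : br (J x) y - br (J y) x \in aJ.
  by rewrite (mem_der_J CL) -E memvB ?memvD ?(mem_br CL).
by split=> //; rewrite E (der_JJ CL).
Qed.

Lemma sum_br_J : \sum_i br (e i) (J (e i)) = 0.
Proof.
have := sk_bal SB; under eq_bigr => i _ do rewrite (sb_self CL) -JN -(bilNr B).
have -> : \sum_i J (br (e i) (- J (e i))) = J (- \sum_i br (e i) (J (e i))).
  by rewrite -sumrN linear_sum; apply: eq_bigr => i _; rewrite (bilNr B).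
by rewrite -[RHS](linear0 J) => /(J_inj CL)/eqP; rewrite oppr_eq0 => /eqP.
Qed.

Section Idempotent.
Context (q : g).
Hypotheses (qa : q \in a) (qq : br (J q) q = q).
Let D x := br (J q) x.

(** All three terms of [skt_derJ] are equal to |x|^2. *)
Let inj1 x : x \in aJ -> D x = x -> x = 0.
Proof.
move=> xJ Dx; have := skt_derJ SB xJ qa; rewrite qq -/(D x) Dx -/(D x) Dx => hx.
by apply: (inn_eq0 hI); move: hx; lra.
Qed.

Let fixC x y : x \in a -> D x = x -> y \in a -> D y = y -> br (J x) y = br (J y) x.
Proof.
move=> xa Dx ya Dy; apply/eqP; rewrite -subr_eq0; apply/eqP/inj1.
  exact: J_br_sub.
by rewrite /D (bilBr B) !(ad_comm CL (J q)) // -/(D y) -/(D x) Dx Dy.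
Qed.

(** On vectors of [a] fixed by D, c vanishes and s(u, v) = J[Ju, v]; this is what remains of the SKT
    identity at (q, x). *)
Let fix_skt x : x \in a -> D x = x -> h q (br (J x) x) = h x x.
Proof.
move=> xa Dx; set w := br (J x) x.
have wa : w \in a by apply: mem_br CL _ _.
have Dw : D w = w by rewrite /D /w (ad_comm CL (J q)) // -/(D x) Dx.
have c0 u v : u \in a -> D u = u -> v \in a -> D v = v -> c u v = 0.
  move=> ua Du va Dv; rewrite cb.unlock (brJJ CL) (br_der0 CL ua va) !add0r.
  by rewrite (brC CL u) JN (fixC ua Du va Dv) subrr oppr0.
have xq : br (J x) q = x by rewrite (fixC xa Dx qa qq).
have := sk_skt SB q x; rewrite /skt_form c0 // (sb_der CL xa qa) xq.
rewrite (sb_der CL qa xa) -/(D x) Dx (sb_der CL xa xa) (sb_der CL qa qa) qq -/w.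
rewrite !(cbJl CL) !c0 // !(sbJl CL) (sb_der CL qa xa) (sb_der CL xa qa) xq.
rewrite -/(D x) Dx (bil0r sB) linear0 !(inn0l hI) !(sk_compat SB) JJ; lra.
Qed.

Let dd x : x \in a -> D (D x) - D x \in aJ.
Proof. by move=> xa; rewrite -memvN opprB; have := adJ_mul CL qa qa xa; rewrite qq. Qed.

(** The balanced condition is read modulo the ideal K = (D - 1)a. It says that the sum of all
    [Jv, v], for v = [e_i, q] and v = [Je_i, q], lies in K; being fixed by D, this sum is 0. Since
    h(q, [Jv, v]) = |v|^2 by [fix_skt], every v vanishes, so q is central and q = [Jq, q] = 0. *)
Lemma idempotent0 : q = 0.
Proof.
have Flin k x y : D (k *: x + y) - (k *: x + y) = k *: (D x - x) + (D y - y).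
  by rewrite /D B.2 opprD addrACA scalerBr.
have [F FE] := lfun_of Flin.
pose K := (F @: a)%VS.
have KP x : x \in K <-> exists2 y, y \in a & x = D y - y.
  split=> [/memv_imgP[y ya ->]|[y ya ->]]; first by exists y; rewrite ?FE.
  by rewrite -FE memv_img.
have JK x : x \in aJ -> x \in K.
  move=> xJ; have FJ : (F @: aJ <= aJ)%VS.
    by apply/subvP => _ /memv_imgP[y yJ ->]; rewrite FE memvB ?(adJ_mem CL).
  have [|y yJ <-] := lfun_inj_surj FJ _ xJ; last by rewrite memv_img ?(der_J_a CL).
  by move=> y yJ; rewrite FE => /eqP; rewrite subr_eq0 => /eqP; apply: inj1.
have K0 x : x \in K -> D x = x -> x = 0.
  move=> /KP[y ya ->] Dx; apply: inj1 (Dx); rewrite -Dx.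
  by rewrite /D (bilBr B); apply: dd.
have Kad y x : x \in K -> br y x \in K.
  move=> /KP[w wa ->]; apply/KP; exists (br y w); first exact: mem_br CL _ _.
  by rewrite (bilBr B) /D (ad_comm CL (J q)).
(* Modulo K, [y, Jy] equals D[y, Jy]. Leibniz expands the latter, and modulo [aJ], which lies in K,
   [Jq, y] and [Jq, Jy] may be replaced by [Jy, q] and -[y, q]. *)
have key y : br y (J y) + (br (J (br (J y) q)) (br (J y) q)
                          + br (J (br y q)) (br y q)) \in K.
  have adq v : br v (br v q) = br (J (br v q)) (br v q).
    have ma := mem_br CL v q.
    have Dm : D (br v q) = br v q by rewrite /D (ad_comm CL (J q)) // qq.
    by rewrite -{1}Dm /D (fixC qa qq ma Dm) (ad_comm CL v _ qa).
  have [m1 m2] := br_Jl_sub y qa.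
  have := memvB (Kad y _ (JK _ m2)) (Kad (J y) _ (JK _ m1)).
  rewrite (bilDr B) (bilBr B) !adq => mm.
  have TK : br y (J y) - D (br y (J y)) \in K.
    rewrite -memvN opprB; apply/KP; exists (br y (J y)) => //; exact: mem_br CL _ _.
  have := memvD TK mm.
  rewrite /D (br_der CL (J q)) (brC CL (br (J q) y)).
  congr (_ \in K).
  by apply: vec_ext => f fD fN _ _; rewrite !(fD, fN); ring.
have sum0 : \sum_i (br (J (br (J (e i)) q)) (br (J (e i)) q)
                    + br (J (br (e i) q)) (br (e i) q)) = 0.
  apply: K0.
    have : \sum_i (br (e i) (J (e i)) + (br (J (br (J (e i)) q)) (br (J (e i)) q)
                    + br (J (br (e i) q)) (br (e i) q))) \in K.
      by apply: memv_suml => i _; apply: key.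
    by rewrite big_split /= sum_br_J add0r.
  rewrite /D (bil_sumr B); apply: eq_bigr => i _; rewrite (bilDr B).
  by rewrite !(ad_comm CL (J q) (J _)) ?(mem_br CL) // !(ad_comm CL (J q)) // qq.
have br0 i : br (e i) q = 0.
  have := congr1 (h q) sum0; rewrite (inn0r hI) (inn_sumr hI).
  have ge0 j : true -> 0 <= h q (br (J (br (J (e j)) q)) (br (J (e j)) q)
                    + br (J (br (e j) q)) (br (e j) q)).
    rewrite (innDr hI) !fix_skt ?addr_ge0 ?(inn_ge0 hI) ?(mem_br CL) //.
    + by rewrite /D (ad_comm CL (J q)) // qq.
    + by rewrite /D (ad_comm CL (J q)) // qq.
  move=> /(psumr_eq0P ge0)/(_ i isT).
  rewrite (innDr hI) !fix_skt ?(mem_br CL) //.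
  + move=> hh; apply: (inn_eq0 hI); move: hh (inn_ge0 hI (br (e i) q)).
    by move: (inn_ge0 hI (br (J (e i)) q)); lra.
  + by rewrite /D (ad_comm CL (J q)) // qq.
  + by rewrite /D (ad_comm CL (J q)) // qq.
rewrite -qq; move: (J q); apply: (span_ind SB) => //; first exact: (bil0l B).
by move=> k x y Ex Ey; rewrite B.1 Ex Ey scaler0 addr0.
Qed.

End Idempotent.

(** Lifts an idempotent from a / aJ to [a]: D - 1 maps [aJ] onto itself, so some v in [aJ] corrects
    p to a true idempotent p - v, and ad(Jv) = 0 on [a] leaves D unchanged there. *)
Lemma no_idempotent p : p \in a -> br (J p) p - p \in aJ -> p \in aJ.
Proof.
move=> pa pJ; pose D x := br (J p) x.
have Flin k x y : D (k *: x + y) - (k *: x + y) = k *: (D x - x) + (D y - y).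
  by rewrite /D B.2 opprD addrACA scalerBr.
have [F FE] := lfun_of Flin.
have FJ : (F @: aJ <= aJ)%VS.
  by apply/subvP => _ /memv_imgP[y yJ ->]; rewrite FE memvB ?(adJ_mem CL).
have Fi x : x \in aJ -> F x = 0 -> x = 0.
  move=> xJ; rewrite FE => /eqP; rewrite subr_eq0 => /eqP Dx.
  have := skt_derJ SB xJ pa; have -> : br (J (br (J p) p)) x = x.
    by have := adJ_derJ CL pJ (der_J_a CL xJ); rewrite linearB /= (bilBl B) -/(D x) Dx => /eqP;
      rewrite subr_eq0 => /eqP.
  rewrite -/(D x) Dx -/(D x) Dx => hx; apply: (inn_eq0 hI); lra.
have [v vJ vE] := lfun_inj_surj FJ Fi pJ.
have va := der_J_a CL vJ.
have Dq x : x \in a -> br (J (p - v)) x = D x.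
  by move=> xa; rewrite linearB /= (bilBl B) (adJ_derJ CL vJ xa) subr0.
suff /eqP : p - v = 0 by rewrite subr_eq0 => /eqP ->.
apply: idempotent0; first by rewrite memvB.
rewrite Dq ?memvB // /D (bilBr B) -/(D p) -/(D v).
have -> : D p = D v - v + p by rewrite -FE vE subrK.
by apply: vec_ext => f fD fN _ _; rewrite !(fD, fN); ring.
Qed.

(** A Fitting argument in a / aJ. Once the images of the powers of D = ad(Jz) stabilize at U m,
    multiplication by u = D^m z, the (m + 1)-st power of z, maps U m onto itself. So u * p = u and u
    * t = p for some p and t; p is idempotent, hence 0, hence u = 0, and U m lies in [aJ]. *)
Lemma adJ_nilpotent z : z \in a ->
  exists m, forall x, x \in a -> iter m (br (J z)) x \in aJ.
Proof.
move=> za; have [F FE] := lfun_of (fun k x y => B.2 k x y (J z)).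
pose U m := iter m (fun W => (F @: W + aJ)%VS) a.
have Ua m : (U m <= a)%VS.
  case: m => [|m] /=; first exact: subvv.
  rewrite subv_add capvSl andbT; apply/subvP => _ /memv_imgP[x _ ->].
  by rewrite FE (mem_br CL).
have UJ m x : x \in aJ -> x \in U m.
  by case: m => [/(der_J_a CL) //|m] xJ; apply: (subvP (addvSr _ _)).
have US m : (U m.+1 <= U m)%VS.
  elim: m => [|m IH]; first exact: (Ua 1%N).
  by apply: addvS => //; apply: limgS.
have Uiter m y : y \in a -> iter m (br (J z)) y \in U m.
  move=> ya; elim: m => //= m IH; apply: (subvP (addvSl _ _)).
  by rewrite -FE memv_img.
have Upre m x : x \in U m.+1 -> exists2 y, y \in U m & x - br (J z) y \in aJ.
  case/memv_addP=> _ /memv_imgP[y yU ->] [j jJ ->]; exists y => //.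
  by rewrite FE addrC addKr.
have [m minm] : exists m, forall k, (\dim (U m) <= \dim (U k))%N.
  have exd : exists d, `[< exists k, \dim (U k) = d >].
    by exists (\dim (U 0%N)); apply/asboolP; exists 0%N.
  case: (ex_minnP exd) => d /asboolP[m mE] mind.
  by exists m => k; rewrite mE; apply: mind; apply/asboolP; exists k.
have Ust : U m = U m.+1.
  by apply/esym/eqP; rewrite eqEdim US minm.
have UmJ x : x \in a -> x \in U m -> exists2 y, y \in U m & x - br (J z) y \in aJ.
  by move=> _; rewrite {1}Ust; apply: Upre.
have Usurj k x : x \in U m -> exists2 y, y \in U m & x - iter k (br (J z)) y \in aJ.
  elim: k x => [|k IH] x xU; first by exists x; rewrite //= subrr mem0v.
  have [y yU xy] := UmJ x (subvP (Ua m) _ xU) xU.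
  have [w wU yw] := IH y yU; exists w => //=.
  have := memvD xy (adJ_mem CL za yw).
  by rewrite (bilBr B) addrA subrK.
have iter_a k x : x \in a -> iter k (br (J z)) x \in a.
  by move=> xa; rewrite (subvP (Ua k)) // Uiter.
have ad_iter k x : x \in a ->
    br (J (iter k (br (J z)) z)) x - iter k.+1 (br (J z)) x \in aJ.
  move=> xa; elim: k => [|k IH] /=; first by rewrite subrr mem0v.
  have := memvD (adJ_mul CL za (iter_a k _ za) xa) (adJ_mem CL za IH).
  by rewrite (bilBr B) addrA subrK.
pose u := iter m (br (J z)) z.
have ua : u \in a by exact: iter_a.
have Uadu x : x \in U m -> exists2 y, y \in U m & x - br (J u) y \in aJ.
  move=> /(Usurj m.+1)[y yU xy]; exists y => //.
  have := memvB xy (ad_iter m _ (subvP (Ua m) _ yU)).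
  by rewrite opprB addrA subrK.
have aU x : x \in U m -> x \in a by exact: subvP (Ua m) x.
have [p pU up] := Uadu _ (Uiter m _ za); rewrite -/u in up.
have [t tU pt] := Uadu _ pU.
(* Modulo [aJ], p * p = p * (u * t) = (u * p) * t = u * t = p. *)
have pJ : p \in aJ.
  apply: no_idempotent; first exact: aU.
  have e1 := adJ_mem CL (aU _ pU) pt; rewrite (bilBr B) in e1.
  have e2 := adJ_mul CL ua (aU _ pU) (aU _ tU).
  have e3 := adJ_derJ CL up (aU _ tU).
  rewrite linearB /= (bilBl B) in e3; move/eqP: e3; rewrite subr_eq0 => /eqP e3.
  rewrite -e3 (ad_comm CL (J u) (J p) (aU _ tU)) in e2.
  have := memvB (memvB e1 e2) pt; congr (_ \in aJ).
  by apply: vec_ext => f fD fN _ _; rewrite !(fD, fN); ring.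
have uJ : u \in aJ.
  by have := memvD up (adJ_mem CL ua pJ); rewrite subrK.
exists m => x /(Uiter m) /Uadu[y yU]; rewrite (adJ_derJ CL uJ) ?subr0 //; exact: aU.
Qed.

Lemma adJ_skew z : z \in a -> forall x x', x \in aJ -> x' \in aJ ->
  h (br (J z) x) x' = - h x (br (J z) x').
Proof. by move=> za; have [m nil] := adJ_nilpotent za; exact: (adJ_skew_nil SB za nil). Qed.

End Nilpotency.

(** * The case where ad(Ja) vanishes on aJ *)

Section Splitting.
Context {R : rcfType} {g : vectType R}.
Implicit Types (x y z w : g) (U W : {vspace g}).
Context (br : g -> g -> g) (J : 'End(g)) (h : g -> g -> R) (n : nat) (e : 'I_n -> g).
Hypothesis SB : skt_balanced br J h e.
Local Notation c := (cb br J).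
Local Notation s := (sb br J).
Local Notation a := (lie_der br).
Local Notation aJ := (der_J br J).
Let CL := sk_cl SB.
Let hI := sk_inner SB.
Let B := cl_bilin CL.
Let cB := cb_bilin CL.
Let sB := sb_bilin CL.
Let JJ := cl_JJ CL.
Let JD x y : J (x + y) = J x + J y. Proof. exact: linearD. Qed.
Let JZ k x : J (k *: x) = k *: J x. Proof. exact: linearZ. Qed.
Hypothesis adJ0 : forall z x, z \in a -> x \in aJ -> br (J z) x = 0.

Definition der_span : {vspace g} := (a + J @: a)%VS.
Local Notation b := der_span.

Lemma der_span_der x : x \in a -> x \in b.
Proof. exact: subvP (addvSl _ _) x. Qed.
Lemma der_span_J x : x \in b -> J x \in b.
Proof.
case/memv_addP=> u ua [_ /memv_imgP[v va ->] ->].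
by rewrite JD JJ addrC memv_add ?memvN ?memv_img.
Qed.
Lemma der_span_derJ x : x \in aJ -> x \in b.
Proof. by move=> /(der_J_a CL)/der_span_der. Qed.
Lemma sb_span x y : s x y \in b.
Proof. by rewrite sb.unlock memv_add ?memv_img ?(mem_br CL). Qed.
Lemma der_span_ind (P : g -> Prop) : (forall x y, P x -> P y -> P (x + y)) ->
  (forall x, x \in a -> P x) -> (forall x, x \in a -> P (J x)) ->
  forall x, x \in b -> P x.
Proof.
move=> PD Pa PJ x /memv_addP[u ua [_ /memv_imgP[v va ->] ->]].
by apply: PD; [apply: Pa|apply: PJ].
Qed.

Definition adJ_killed u := u \in a /\ forall z, z \in a -> br (J z) u = 0.
Local Notation kills := adJ_killed.

Let kills0 : kills 0.
Proof. by split=> [|z _]; rewrite ?mem0v ?(bil0r B). Qed.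
Let killsD k u v : kills u -> kills v -> kills (k *: u + v).
Proof.
move=> [ua Du] [va Dv]; split=> [|z za]; first by rewrite memvD ?memvZ.
by rewrite B.2 Du // Dv // scaler0 addr0.
Qed.

(** [S] is N + JN for the annihilator N of ad(Ja) in [a]. It lies between [aJ] and [b]; the
    adjunction of c and s is first proved on [S], which in the end turns out to be [b]. *)
Lemma kill_space_exists : exists S : {vspace g}, forall x,
  x \in S <-> exists u v, [/\ kills u, kills v & x = u + J v].
Proof.
apply: vspace_of_pred.
  by exists 0, 0; split=> //; rewrite linear0 addr0.
move=> k _ _ [u [v [ku kv ->]]] [u' [v' [ku' kv' ->]]].
exists (k *: u + u'), (k *: v + v'); split; try exact: killsD.
by rewrite scalerDr JD JZ addrACA.
Qed.

Section KillSpace.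
Context (S : {vspace g}).
Hypothesis SP : forall x, x \in S <-> exists u v, [/\ kills u, kills v & x = u + J v].

Lemma kill_der u : u \in a -> (forall z, z \in a -> br (J z) u = 0) -> u \in S.
Proof. by move=> ua Du; apply/SP; exists u, 0; split=> //; rewrite linear0 addr0. Qed.
Lemma kill_J x : x \in S -> J x \in S.
Proof.
move=> /SP[u [v [ku kv ->]]]; apply/SP; exists (- v), u; split=> //.
  by rewrite -scaleN1r -[_ *: v]addr0; apply: killsD.
by rewrite JD JJ addrC.
Qed.
Lemma kill_derJ x : x \in aJ -> x \in S.
Proof. by move=> xJ; apply: kill_der => [|z za]; rewrite ?(der_J_a CL) ?adJ0. Qed.
Lemma kill_span x : x \in S -> x \in b.
Proof. by move=> /SP[u [v [[ua _] [va _] ->]]]; rewrite memv_add ?memv_img. Qed.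

Lemma sb_kill y x : x \in S -> s y x \in S.
Proof.
have ks u : kills u -> s y u \in S.
  move=> [ua Du]; rewrite sb.unlock memvD //; last apply: kill_J.
    by apply: kill_der => [|z za]; rewrite ?(mem_br CL) // (ad_comm CL) // Du // (bil0r B).
  by apply: kill_der => [|z za]; rewrite ?(mem_br CL) // (ad_comm CL) // Du // (bil0r B).
by move=> /SP[u [v [ku kv ->]]]; rewrite (bilDr sB) (sbJr CL) memvD ?kill_J ?ks.
Qed.

Lemma sb_span_kill z x : z \in b -> x \in S -> s z x = 0.
Proof.
move=> zb xS; move: z zb; apply: der_span_ind => [z w zx wx|z za|z za].
- by rewrite (bilDl sB) zx wx addr0.
- case/SP: xS => u [v [[ua Du] [va Dv] ->]].
  by rewrite (bilDr sB) (sbJr CL) !(sb_der CL) // Du // Dv // !linear0 addr0.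
rewrite (sbJl CL); case/SP: xS => u [v [[ua Du] [va Dv] ->]].
by rewrite (bilDr sB) (sbJr CL) !(sb_der CL) // Du // Dv // !linear0 addr0 linear0 oppr0.
Qed.

Let skt_kill x y : x \in S ->
  h (c y x) (c y x) + h (s y x) (s y x) + 2 * h (c y (s y x)) x
  + h (s x y) (s x y) + 2 * h (c (s y y) x) x = 0.
Proof.
move=> xS; have xb := kill_span xS.
have := sk_skt SB x y; rewrite /skt_form (sb_span_kill xb xS).
rewrite (sb_span_kill xb (kill_derJ (cb_derJ CL _ _))).
rewrite (sb_span_kill (sb_span _ _) xS) (bil0l sB) !(inn0l hI).
rewrite (cbC CL x y) (cbC CL (s y x)) !(innNl hI) (innNr hI); lra.
Qed.

(** For y = e_i, the sum of [skt_kill] over X reads |c_y + s_y^T|^2 + sum_l |s(X_l, y)|^2 + 2 tr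
    c(s(y, y), .) = 0. Summed over i, the traces cancel by the balanced condition, so all squares
    vanish. *)
Let kill_zero n' (X : 'I_n' -> g) (oX : onb h X S) i l k :
  s (X l) (e i) = 0 /\ h (c (e i) (X k)) (X l) = - h (X k) (s (e i) (X l)).
Proof.
have XS j : X j \in S by exact: onb_mem oX j.
pose Q j := \sum_l \sum_k (h (c (e j) (X k)) (X l) + h (s (e j) (X l)) (X k)) ^+ 2.
pose N j := \sum_l h (s (X l) (e j)) (s (X l) (e j)).
have Q0 j : 0 <= Q j by apply: sumr_ge0 => l' _; apply: sumr_ge0 => *; apply: sqr_ge0.
have N0 j : 0 <= N j by apply: sumr_ge0 => l' _; apply: inn_ge0.
have QE j : Q j + N j + 2 * \sum_l h (c (s (e j) (e j)) (X l)) (X l) = 0.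
  rewrite /Q -(trace_square hI oX (A := c (e j)) (L := s (e j))).
  - rewrite /N mulr_sumr -2!big_split big1 //= => l' _; exact: skt_kill.
  - by move=> *; rewrite cB.2.
  - by move=> l'; rewrite kill_derJ ?(cb_derJ CL).
  - by move=> l'; rewrite sb_kill.
have : \sum_j (Q j + N j) = 0.
  have : \sum_j (Q j + N j + 2 * \sum_l h (c (s (e j) (e j)) (X l)) (X l)) = 0.
    by rewrite big1 // => j _; exact: QE.
  rewrite big_split /= -mulr_sumr exchange_big /= (big1 _ _ (fun l => \sum_(_ < n) _)).
    by rewrite mulr0 addr0.
  move=> l' _; rewrite -(inn_suml hI) -(bil_suml cB) (sk_bal SB) (bil0l cB).
  by rewrite (inn0l hI).
move/psumr_eq0P => /(_ (fun j _ => addr_ge0 (Q0 j) (N0 j)) i isT) QN.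
have [Qi Ni] : Q i = 0 /\ N i = 0 by move: (Q0 i) (N0 i); lra.
split.
  apply: (inn_eq0 hI).
  by move/psumr_eq0P: Ni => /(_ (fun j _ => inn_ge0 hI _) l isT).
move/psumr_eq0P: Qi => /(_ (fun j _ => sumr_ge0 _ (fun k _ => sqr_ge0 _)) l isT).
move/psumr_eq0P => /(_ (fun j _ => sqr_ge0 _) k isT) /eqP.
by rewrite sqrf_eq0 addr_eq0 (innC hI (s _ _)) => /eqP.
Qed.

Lemma kill_sb0 x y : x \in S -> s x y = 0.
Proof.
have [m [X oX]] := onb_exists hI S.
move: x; apply: (onb_ind oX); first exact: (bil0l sB).
  by move=> k u v Eu Ev; rewrite sB.1 Eu Ev scaler0 addr0.
move=> l; move: y; apply: (span_ind SB); first exact: (bil0r sB).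
  by move=> k u v Eu Ev; rewrite sB.2 Eu Ev scaler0 addr0.
by move=> i; have [] := kill_zero oX i l l.
Qed.

Lemma kill_adj y x x' : x \in S -> x' \in S -> h (c y x) x' = - h x (s y x').
Proof.
have [m [X oX]] := onb_exists hI S.
move=> xS; move: x'; apply: (onb_ind oX).
- by rewrite (bil0r sB) !(inn0r hI) oppr0.
- by move=> k u v Eu Ev; rewrite sB.2 !(innDr hI) !(innZr hI) Eu Ev; ring.
move=> l; move: x xS; apply: (onb_ind oX).
- by rewrite (bil0r cB) !(inn0l hI) oppr0.
- by move=> k u v Eu Ev; rewrite cB.2 !(innDl hI) !(innZl hI) Eu Ev; ring.
move=> k; move: y; apply: (span_ind SB).
- by rewrite (bil0l sB) (bil0l cB) (inn0l hI) (inn0r hI) oppr0.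
- move=> t u v Eu Ev; rewrite sB.1 cB.1 !(innDl hI) !(innDr hI) !(innZl hI) !(innZr hI).
  by rewrite Eu Ev; ring.
by move=> i; have [] := kill_zero oX i l k.
Qed.

Lemma derJ_sb0 x y : x \in aJ -> s x y = 0.
Proof. by move=> /kill_derJ; apply: kill_sb0. Qed.
Lemma br_derJ2 y x : x \in aJ -> br y x *+ 2 = c y x + s y x.
Proof. by move=> xJ; rewrite (brE CL) (derJ_sb0 _ xJ) subr0. Qed.
Lemma br_derJ y x : x \in aJ -> br y (J x) = J (br y x).
Proof.
move=> xJ; have : br y (J x) *+ 2 = J (br y x) *+ 2.
  rewrite br_derJ2 ?(der_JJ CL) // (cbJr CL) (sbJr CL) -JD -br_derJ2 //.
  exact: linearMn.
move=> /(congr1 (fun v => 2%:R^-1 *: v)).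
by rewrite -!scaler_nat !scalerA mulVf ?pnatr_eq0 // !scale1r.
Qed.
Lemma br_derJ_mem y x : x \in aJ -> br y x \in aJ.
Proof. by move=> xJ; rewrite (mem_der_J CL) -br_derJ // !(mem_br CL). Qed.
Lemma br_derJ_skew y x x' : x \in aJ -> x' \in aJ -> h (br y x) x' = - h x (br y x').
Proof.
move=> xJ x'J; have E1 := kill_adj y (kill_derJ xJ) (kill_derJ x'J).
have E2 := kill_adj y (kill_derJ x'J) (kill_derJ xJ).
have : h (br y x *+ 2) x' = - h x (br y x' *+ 2).
  rewrite !br_derJ2 // (innDl hI) (innDr hI) E1 (innC hI (s y x)) opprD.
  by rewrite (innC hI x (c y x')) E2 opprK addrC.
by rewrite !mulr2n (innDl hI) (innDr hI); lra.
Qed.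

(* Seminegative on aJ, on which g acts by skew maps; as it maps a to aJ, it
   annihilates [Ja, a]. *)
Definition delta x := \sum_i (br (e i) (br (e i) x) + br (J (e i)) (br (J (e i)) x)).

Lemma deltaD x y : delta (x + y) = delta x + delta y.
Proof.
rewrite -big_split; apply: eq_bigr => i _; rewrite !(bilDr B).
by rewrite addrACA.
Qed.

(** By Leibniz and [br_Jl_sub], [Jx, [y, Jy]] is, modulo [aJ], the negative of the summand of
    [delta x] for y. The sum of the [e_i, Je_i] is 0. *)
Lemma delta_derJ x : x \in a -> delta x \in aJ.
Proof.
move=> xa; have key y : br (J x) (br y (J y)) +
    (br y (br y x) + br (J y) (br (J y) x)) \in aJ.
  have [m1 m2] := br_Jl_sub SB y xa.
  have := memvB (br_derJ_mem y m2) (br_derJ_mem (J y) m1).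
  rewrite (bilDr B) (bilBr B) (br_der CL (J x)) (brC CL (br (J x) y)).
  by congr (_ \in aJ); apply: vec_ext => f fD fN _ _; rewrite !(fD, fN); ring.
have : \sum_i (br (J x) (br (e i) (J (e i))) +
    (br (e i) (br (e i) x) + br (J (e i)) (br (J (e i)) x))) \in aJ.
  by apply: memv_suml => i _; apply: key.
by rewrite big_split /= -(bil_sumr B) (sum_br_J SB) (bil0r B) add0r.
Qed.

(** On [a], [delta] commutes with ad(Jz), and ad(Jz) kills [delta u], which lies in [aJ]. *)
Lemma delta_adJ z u : z \in a -> u \in a -> delta (br (J z) u) = 0.
Proof.
move=> za ua; rewrite -[RHS](adJ0 za (delta_derJ ua)) (bil_sumr B).
apply: eq_bigr => i _; rewrite (bilDr B).
by rewrite !(ad_comm CL _ (J z)) ?(mem_br CL).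
Qed.

Lemma delta_eq0 x : x \in aJ -> delta x = 0 -> forall y, br y x = 0.
Proof.
move=> xJ d0; have E i : h (br (e i) (br (e i) x) + br (J (e i)) (br (J (e i)) x)) x
    = - (h (br (e i) x) (br (e i) x) + h (br (J (e i)) x) (br (J (e i)) x)).
  by rewrite (innDl hI) !br_derJ_skew ?br_derJ_mem // opprD.
have := congr1 (h^~ x) d0; rewrite /= (inn0l hI) (inn_suml hI).
rewrite (eq_bigr _ (fun i _ => E i)) sumrN => /eqP; rewrite oppr_eq0 => /eqP.
move/psumr_eq0P => E0.
apply: (span_ind SB); first exact: (bil0l B).
  by move=> k u v Eu Ev; rewrite B.1 Eu Ev scaler0 addr0.
move=> i; have := E0 (fun i _ => addr_ge0 (inn_ge0 hI _) (inn_ge0 hI _)) i isT.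
move=> H; apply: (inn_eq0 hI).
by move: H (inn_ge0 hI (br (e i) x)) (inn_ge0 hI (br (J (e i)) x)); lra.
Qed.

(** Equivalently, both x and Jx are central. *)
Definition J_central x := forall y, [/\ c y x = 0, s x y = 0 & s y x = 0].

(** Replacing y by Jy changes the relative sign of the two terms in 2[y, x] = c(y, x) + s(y, x), so
    both terms vanish. *)
Lemma J_centralP x : x \in aJ -> (forall y, br y x = 0) -> J_central x.
Proof.
move=> xJ br0 y; have e1 := br_derJ2 y xJ; have e2 := br_derJ2 (J y) xJ.
have e3 : c y x = s y x.
  apply: (J_inj CL); apply/eqP; rewrite -subr_eq0 -(cbJl CL) -(sbJl CL) -e2.
  by rewrite br0 mul0rn.
have s0 : s y x = 0.
  move: e1; rewrite br0 mul0rn e3 -mulr2n -scaler_nat => /esym/eqP.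
  by rewrite scaler_eq0 pnatr_eq0 => /eqP.
by split; rewrite ?e3 // derJ_sb0.
Qed.

Lemma J_central_br x y : J_central x -> br y x = 0.
Proof.
move=> /(_ y)[cx sx sx']; have := brE CL y x; rewrite cx sx sx' !addr0 subr0 -scaler_nat.
by move/eqP; rewrite scaler_eq0 pnatr_eq0 => /eqP.
Qed.
Lemma J_centralJ x : J_central x -> J_central (J x).
Proof.
move=> xc y; have [cx sx sx'] := xc y.
by split; rewrite ?(cbJr CL) ?(sbJr CL) ?(sbJl CL) ?cx ?sx ?sx' ?linear0 ?oppr0.
Qed.
Lemma J_centralD k x y : J_central x -> J_central y -> J_central (k *: x + y).
Proof.
move=> xc yc z; have [cx sx sx'] := xc z; have [cy sy sy'] := yc z.
by split; rewrite ?cB.2 ?sB.1 ?sB.2 ?cx ?sx ?sx' ?cy ?sy ?sy' scaler0 addr0.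
Qed.
Lemma J_central0 : J_central 0.
Proof. by move=> y; split; rewrite ?(bil0r cB) ?(bil0l sB) ?(bil0r sB). Qed.

(** [I] consists of [aJ] and the J-central vectors of [b]. It is a second approximation to [b],
    shown to be all of [b] by means of [ideal_absorb]. *)
Lemma ideal_space_exists : exists I : {vspace g}, forall x,
  x \in I <-> exists u v, [/\ u \in aJ, v \in b, J_central v & x = u + v].
Proof.
apply: vspace_of_pred.
  by exists 0, 0; split; rewrite ?mem0v ?addr0 //; apply: J_central0.
move=> k _ _ [u [v [uJ vb vc ->]]] [u' [v' [u'J v'b v'c ->]]].
exists (k *: u + u'), (k *: v + v'); split; rewrite ?memvD ?memvZ //.
  exact: J_centralD.
by rewrite scalerDr addrACA.
Qed.

Section Ideal.
Context (I : {vspace g}).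
Hypothesis IP : forall x, x \in I <->
  exists u v, [/\ u \in aJ, v \in b, J_central v & x = u + v].

Lemma ideal_derJ x : x \in aJ -> x \in I.
Proof.
move=> xJ; apply/IP; exists x, 0; split; rewrite ?mem0v ?addr0 //.
exact: J_central0.
Qed.
Lemma ideal_central x : x \in b -> J_central x -> x \in I.
Proof. by move=> xb xc; apply/IP; exists 0, x; split; rewrite ?mem0v ?add0r. Qed.
Lemma ideal_J x : x \in I -> J x \in I.
Proof.
move=> /IP[u [v [uJ vb vc ->]]]; apply/IP; exists (J u), (J v).
by split; [exact: der_JJ|exact: der_span_J|exact: J_centralJ|rewrite JD].
Qed.
Lemma ideal_span x : x \in I -> x \in b.
Proof. by move=> /IP[u [v [uJ vb vc ->]]]; rewrite memvD // der_span_derJ. Qed.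
Lemma ideal_sb0l x y : x \in I -> s x y = 0.
Proof.
move=> /IP[u [v [uJ vb vc ->]]]; rewrite (bilDl sB) derJ_sb0 //.
by have [_ -> _] := vc y; rewrite addr0.
Qed.
Lemma ideal_sb0r z x : z \in b -> x \in I -> s z x = 0.
Proof.
move=> zb /IP[u [v [uJ vb vc ->]]]; rewrite (bilDr sB) sb_span_kill ?kill_derJ //.
by have [_ _ ->] := vc z; rewrite addr0.
Qed.
Lemma ideal_cb0 z x : z \in b -> x \in I -> c z x = 0.
Proof.
move=> zb /IP[u [v [uJ vb vc ->]]]; rewrite (bilDr cB).
have [-> _ _] := vc z; rewrite addr0 (cbC CL); apply/eqP; rewrite oppr_eq0; apply/eqP.
move: z zb; apply: der_span_ind => [z w zx wx|z za|z za].
- by rewrite (bilDr cB) zx wx addr0.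
- by rewrite (cb_derJ_der CL) // sb_span_kill ?kill_derJ ?der_span_der.
by rewrite (cbJr CL) (cb_derJ_der CL) // sb_span_kill ?kill_derJ ?der_span_der // linear0.
Qed.
Lemma ideal_adJ0 z x : z \in a -> x \in I -> br (J z) x = 0.
Proof.
move=> za /IP[u [v [uJ vb vc ->]]].
by rewrite (bilDr B) adJ0 // (J_central_br _ vc) addr0.
Qed.

(** The part x of u orthogonal to [I] is shown to be J-central; then it lies in [I] and vanishes.
    With each e_i also replaced by its part f_i orthogonal to [I], the SKT identity at (x, f_i)
    leaves three squares with sum 2 h(J[Ju, u], s(f_i, f_i)), and these right-hand sides add up to
    0. *)
Lemma ideal_absorb u : u \in a -> (forall z, z \in a -> br (J z) u \in I) -> u \in I.
Proof.
move=> ua Du; have [m [X oX]] := onb_exists hI I; pose P := oproj h X.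
have PI x : P x \in I := oproj_mem oX x.
have perpI x v : v \in I -> h (x - P x) v = 0 := fun vI => oproj_perp hI oX x vI.
pose x := u - P u; pose f i := e i - P (e i).
have ub := der_span_der ua.
have xb : x \in b by rewrite memvB // ideal_span.
have sxI z : z \in b -> s z x \in I.
  move=> zb; rewrite /x (bilBr sB) (ideal_sb0r zb (PI u)) subr0; move: z zb.
  apply: der_span_ind => [z w zx wx|z za|z za]; first by rewrite (bilDl sB) memvD.
    by rewrite (sb_der CL) // ideal_J // Du.
  by rewrite (sbJl CL) (sb_der CL) // memvN; do 2 apply: ideal_J; exact: Du.
pose y := br (J u) u.
have sxx : s x x = J y.
  rewrite {1}/x (bilBl sB) (ideal_sb0l _ (PI u)) subr0 /x (bilBr sB).
  by rewrite (ideal_sb0r ub (PI u)) subr0 (sb_der CL).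
have sq i : h (c x (f i)) (c x (f i)) + h (s (f i) x) (s (f i) x)
    + h (s x (f i)) (s x (f i)) = 2 * h (J y) (s (f i) (f i)).
  have cI v w : h (c v w) x = 0 by rewrite (innC hI) perpI // ideal_derJ // (cb_derJ CL).
  have := sk_skt SB x (f i); rewrite /skt_form !cI -sxx.
  rewrite (ideal_sb0r xb (ideal_derJ (cb_derJ CL _ _))) (ideal_sb0l _ (sxI _ xb)).
  rewrite !(inn0l hI) (innC hI _ (f i)) perpI ?sxI ?sb_span //; lra.
(* [delta] kills y by [delta_adJ], and it kills the J-central part of y; so it kills the part in
   [aJ], to which [delta_eq0] applies. *)
have yc : J_central y.
  have /IP[u1 [v1 [u1J v1b v1c yE]]] := Du u ua.
  have dv1 : delta v1 = 0.
    by rewrite /delta big1 // => i _; rewrite !(J_central_br _ v1c) !(bil0r B) addr0.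
  have du1 : delta u1 = 0 by rewrite -[LHS]addr0 -dv1 -deltaD -yE delta_adJ.
  have u1c := J_centralP u1J (delta_eq0 u1J du1).
  by rewrite /y yE -[u1]scale1r; apply: J_centralD.
have yS : y \in S.
  by apply: kill_der; [exact: mem_br CL _ _|move=> z _; apply: J_central_br].
(* Passing from f_i back to e_i changes nothing: for u1 in [aJ], h(Jy, s(e_i, u1)) = - h(c(e_i, Jy),
   u1) = 0. Then the balanced condition applies. *)
have sum0 : \sum_i h (J y) (s (f i) (f i)) = 0.
  have E i : h (J y) (s (f i) (f i)) = h (J y) (s (e i) (e i)).
    rewrite /f (bilBl sB) (ideal_sb0l _ (PI _)) subr0 (bilBr sB) (innBr hI).
    have /IP[u1 [v1 [u1J v1b v1c ->]]] := PI (e i).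
    rewrite (bilDr sB); have [_ _ ->] := v1c (e i); rewrite addr0.
    have := kill_adj (e i) (kill_J yS) (kill_derJ u1J).
    by rewrite (cbJr CL); have [-> _ _] := yc (e i); rewrite linear0 (inn0l hI); lra.
  by rewrite (eq_bigr _ (fun i _ => E i)) -(inn_sumr hI) (sk_bal SB) (inn0r hI).
have xf i : [/\ c x (f i) = 0, s (f i) x = 0 & s x (f i) = 0].
  have : \sum_i (h (c x (f i)) (c x (f i)) + h (s (f i) x) (s (f i) x)
    + h (s x (f i)) (s x (f i))) = 0.
    by rewrite (eq_bigr _ (fun i _ => sq i)) -mulr_sumr sum0 mulr0.
  have q0 := inn_ge0 hI.
  move/psumr_eq0P => /(_ (fun j _ => addr_ge0 (addr_ge0 (q0 _) (q0 _)) (q0 _)) i isT).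
  move: (q0 (c x (f i))) (q0 (s (f i) x)) (q0 (s x (f i))) => p1 p2 p3 p.
  by split; apply: (inn_eq0 hI); lra.
have xc : J_central x.
  apply: (span_ind SB).
  - by split; rewrite ?(bil0l cB) ?(bil0l sB) ?(bil0r sB).
  - move=> k v w [cv sv sv'] [cw sw sw'].
    by split; rewrite ?cB.1 ?sB.1 ?sB.2 ?cv ?sv ?sv' ?cw ?sw ?sw' scaler0 addr0.
  move=> i; have [cf sf sf'] := xf i; have eE : e i = f i + P (e i) by rewrite subrK.
  rewrite eE; split.
  - rewrite (bilDl cB) (cbC CL (f i)) cf (cbC CL (P _)) (ideal_cb0 xb (PI _)).
    by rewrite !oppr0 addr0.
  - by rewrite (bilDr sB) sf' (ideal_sb0r xb (PI _)) addr0.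
  - by rewrite (bilDl sB) sf (ideal_sb0l _ (PI _)) addr0.
have /(perpI u)/(inn_eq0 hI)/eqP := ideal_central xb xc.
by rewrite subr_eq0 => /eqP ->; apply: PI.
Qed.

(** An Engel-type induction on dim M, with N = [Jz, M] + (M meet I). If N is smaller than M, it lies
    in [I] by induction. If N = M, iteration gives M inside (ad Jz)^m M + I, which is in [I] as
    ad(Jz) is nilpotent modulo [aJ]. In both cases [Jz, M] lies in [I], and [ideal_absorb]
    concludes. *)
Lemma ideal_stable M : (M <= a)%VS ->
  (forall z x, z \in a -> x \in M -> br (J z) x \in M) -> (M <= I)%VS.
Proof.
move: {2}(\dim M).+1 (ltnSn (\dim M)) => d; elim: d M => // d IH M.
rewrite ltnS => dM Ma MD.
suff H z x : z \in a -> x \in M -> br (J z) x \in I.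
  by apply/subvP => x xM; apply: ideal_absorb => [|z za]; [exact: subvP Ma x xM|exact: H].
move=> za; have [F FE] := lfun_of (fun k x y => B.2 k x y (J z)).
pose N := (F @: M + (M :&: I))%VS.
have NM : (N <= M)%VS.
  by rewrite subv_add capvSl andbT; apply/subvP => _ /memv_imgP[v vM ->]; rewrite FE MD.
have FN v : v \in M -> br (J z) v \in N.
  by move=> vM; rewrite -FE (subvP (addvSl _ _)) ?memv_img.
have [NE|NM'] := eqVneq N M; last first.
  have : (N <= I)%VS.
    apply: IH; last 2 first.
    - exact: subv_trans NM Ma.
    - move=> w _ wa /memv_addP[_ /memv_imgP[v vM ->] [v' /[!memv_cap]/andP[_ v'I] ->]].
      rewrite FE (bilDr B) (ideal_adJ0 wa v'I) addr0 (ad_comm CL _ _ (subvP Ma _ vM)).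
      exact/FN/MD.
    apply: leq_trans dM; rewrite ltn_neqAle dimvS // andbT.
    by apply: contra NM' => dE; rewrite eqEdim NM (eqP dE) leqnn.
  by move=> NI xM; apply: (subvP NI); apply: FN.
have [m nil] := adJ_nilpotent SB za.
have pre k v : v \in M -> exists2 w, w \in M & v - iter k (br (J z)) w \in I.
  elim: k v => [|k IHk] v vM; first by exists v; rewrite //= subrr mem0v.
  have [w wM vw] := IHk v vM; have : w \in N by rewrite NE.
  move=> /memv_addP[_ /memv_imgP[t tM ->]].
  case=> v' /[!memv_cap]/andP[v'M v'I] wE; exists t => //.
  have itD p q : iter k (br (J z)) (p + q) = iter k (br (J z)) p + iter k (br (J z)) q.
    by elim: k {IHk vw} => //= k' ->; rewrite (bilDr B).
  have itI : iter k (br (J z)) v' \in I.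
    elim: k {IHk vw itD} => //= k; set r := iter k _ _ => rI.
    by rewrite ideal_adJ0 ?mem0v.
  rewrite iterSr; have := memvD vw itI; congr (_ \in I).
  by rewrite wE FE itD opprD addrA subrK.
move=> xM; have [w wM xw] := pre m _ xM.
have := memvD xw (ideal_derJ (nil w (subvP Ma _ wM))); rewrite subrK => xI.
by rewrite ideal_adJ0 ?mem0v.
Qed.

Lemma ideal_full x : x \in b -> x \in I.
Proof.
have aI := ideal_stable (subvv a) (fun z x _ _ => mem_br CL (J z) x).
move: x; apply: der_span_ind => [u v|u ua|u ua]; first exact: memvD.
  exact: subvP aI u ua.
by apply: ideal_J; apply: subvP aI u ua.
Qed.

End Ideal.
End KillSpace.

End Splitting.

(** * The decomposition of g into ker M and im M = a *)

Section Flat.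
Context {R : rcfType} {g : vectType R}.
Implicit Types (x y z w : g) (U W : {vspace g}).
Context (br : g -> g -> g) (J : 'End(g)) (h : g -> g -> R) (n : nat) (e : 'I_n -> g).
Hypothesis SB : skt_balanced br J h e.
Local Notation c := (cb br J).
Local Notation s := (sb br J).
Local Notation a := (lie_der br).
Local Notation aJ := (der_J br J).
Local Notation b := (der_span br J).
Let CL := sk_cl SB.
Let hI := sk_inner SB.
Let B := cl_bilin CL.
Let cB := cb_bilin CL.
Let sB := sb_bilin CL.
Hypothesis adJ0 : forall z x, z \in a -> x \in aJ -> br (J z) x = 0.

(** As [I] is all of [b], ad(Ja) kills [a], so [S] is all of [b] as well, and the facts proved on
    [S] and [I] hold on [b]. *)
Let span_facts :
  [/\ forall x y, x \in b -> s x y = 0,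
      forall y x x', x \in b -> x' \in b -> h (c y x) x' = - h x (s y x'),
      forall x x', x \in b -> x' \in b -> c x x' = 0,
      forall y x, x \in aJ -> br y (J x) = J (br y x) &
      forall y x x', x \in aJ -> x' \in aJ -> h (br y x) x' = - h x (br y x')].
Proof.
have [S SP] := kill_space_exists SB; have [I IP] := ideal_space_exists SB.
have bI := ideal_full SB adJ0 SP IP.
have bS x : x \in b -> x \in S.
  move: x; apply: der_span_ind => [u v|u ua|u ua]; first exact: memvD.
    apply: (kill_der SB SP) => // z za.
    by apply: (ideal_adJ0 SB adJ0 IP) => //; apply/bI/der_span_der.
  apply: (kill_J SB SP); apply: (kill_der SB SP) => // z za.
  by apply: (ideal_adJ0 SB adJ0 IP) => //; apply/bI/der_span_der.
split.
- by move=> x y /bS; apply: (kill_sb0 SB adJ0 SP).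
- by move=> y x x' /bS xS /bS x'S; apply: (kill_adj SB adJ0 SP).
- by move=> x x' xb /bI; apply: (ideal_cb0 SB adJ0 SP IP).
- exact: (br_derJ SB adJ0 SP).
- exact: (br_derJ_skew SB adJ0 SP).
Qed.

Let sb0 x y : x \in b -> s x y = 0. Proof. by case: span_facts => H _ _ _ _; apply: H. Qed.
Let adj y x x' : x \in b -> x' \in b -> h (c y x) x' = - h x (s y x').
Proof. by case: span_facts => _ H _ _ _; apply: H. Qed.
Let cb0 x x' : x \in b -> x' \in b -> c x x' = 0.
Proof. by case: span_facts => _ _ H _ _; apply: H. Qed.
Let cb_b x y : c x y \in b.
Proof. exact: (der_span_derJ SB (cb_derJ CL x y)). Qed.
Let sb_b x y : s x y \in b. Proof. exact: (sb_span SB). Qed.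

Let sb_comm x y z : s x (s y z) = s y (s x z).
Proof. by apply/eqP; rewrite -subr_eq0 (sb_flat CL) sb0. Qed.
Let sb_cb_comm z x u : u \in b -> s z (c x u) = c x (s z u).
Proof.
move=> ub; rewrite (sb_cb CL) (cb0 (sb_b z x) ub) add0r (sb0 _ (sb_b x z)) subr0.
by rewrite (sb0 z ub) (bil0l sB) addr0.
Qed.

Let M_exists : exists M : 'End(g), forall x, M x = \sum_i c (e i) (s (e i) x).
Proof.
apply: lfun_of => k x y; rewrite scaler_sumr -big_split.
by apply: eq_bigr => i _; rewrite sB.2 cB.2.
Qed.

Section Laplacian.
Context (M : 'End(g)) (ME : forall x, M x = \sum_i c (e i) (s (e i) x)).

Let M_derJ x : M x \in aJ.
Proof. by rewrite ME; apply: memv_suml => i _; apply: cb_derJ. Qed.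
Let M_b x : M x \in b. Proof. exact: (der_span_derJ SB). Qed.
Let M_adj x y : y \in b -> h (M x) y = - \sum_i h (s (e i) x) (s (e i) y).
Proof.
move=> yb; rewrite ME (inn_suml hI) -sumrN.
by apply: eq_bigr => i _; rewrite adj.
Qed.
Let M_sb y x : M (s y x) = s y (M x).
Proof.
rewrite !ME (bil_sumr sB); apply: eq_bigr => i _.
by rewrite sb_cb_comm // sb_comm.
Qed.
Let M_J x : M (J x) = J (M x).
Proof.
by rewrite !ME linear_sum; apply: eq_bigr => i _; rewrite (sbJr CL) (cbJr CL).
Qed.
Let M_ker x : x \in b -> M x = 0 -> forall y, s y x = 0.
Proof.
move=> xb Mx; have := M_adj x xb; rewrite Mx (inn0l hI) => /esym/eqP.
rewrite oppr_eq0 => /eqP/psumr_eq0P s0.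
apply: (span_ind SB) => [|k u v Eu Ev|i]; first exact: (bil0l sB).
  by rewrite sB.1 Eu Ev scaler0 addr0.
by apply: (inn_eq0 hI); apply: s0 => // j _; apply: inn_ge0.
Qed.
(** |c(y, x)|^2 = - h(x, s(y, c(y, x))) = - h(x, c(y, s(y, x))) = 0. *)
Let cb_ker x y : x \in b -> (forall y, s y x = 0) -> c y x = 0.
Proof.
move=> xb sx; apply: (inn_eq0 hI); rewrite adj // sb_cb_comm // sx (bil0r cB).
by rewrite (inn0r hI) oppr0.
Qed.
Let M_ker_im x : M (M x) = 0 -> M x = 0.
Proof.
move=> MMx; have sMx := M_ker (M_b x) MMx.
apply: (inn_eq0 hI); rewrite M_adj // big1 ?oppr0 // => i _.
by rewrite sMx (inn0r hI).
Qed.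

Let W := lker M.
Let E := limg M.

Let WE_cap : (W :&: E = 0)%VS.
Proof.
apply/eqP; rewrite -subv0; apply/subvP => x; rewrite memv_cap memv0.
move=> /andP[xW /memv_imgP[y _ xE]]; rewrite xE; apply/eqP/M_ker_im.
by move: xW; rewrite memv_ker xE => /eqP.
Qed.
Let WE_full : (W + E = fullv)%VS.
Proof.
apply/eqP; rewrite eqEdim subvf /= dimv_disjoint_sum // addnC /W /E.
by rewrite -(limg_ker_dim M fullv) capfv addnC.
Qed.
Let decomp x : exists w m, [/\ w \in W, m \in E & x = w + m].
Proof.
have : x \in (W + E)%VS by rewrite WE_full memvf.
by case/memv_addP=> w wW [m mE ->]; exists w, m.
Qed.
Let E_derJ m : m \in E -> m \in aJ.
Proof. by move=> /memv_imgP[x _ ->]. Qed.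
Let E_b m : m \in E -> m \in b.
Proof. by move=> /E_derJ; apply: (der_span_derJ SB). Qed.
Let W_J x : x \in W -> J x \in W.
Proof. by rewrite !memv_ker M_J => /eqP ->; rewrite linear0. Qed.

Let W_sb w y z : w \in W -> s z (s y w) = 0.
Proof.
rewrite memv_ker => /eqP Mw; apply: M_ker => //.
by rewrite M_sb Mw (bil0r sB).
Qed.
Let W_cbsb w x y : w \in W -> c x (s y w) = 0.
Proof. by move=> wW; apply: cb_ker => // z; apply: W_sb. Qed.
Let W_sbcb w w' z : w \in W -> w' \in W -> s z (c w w') = 0.
Proof.
move=> wW w'W; rewrite (sb_cb CL) (cbC CL (s z w)) !W_cbsb // !(sb0 _ (sb_b _ _)).
by rewrite !(oppr0, addr0).
Qed.
(* E is the orthogonal complement in b of the elements killed by all s y. *)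
Let E_perp m x : m \in E -> x \in b -> (forall y, s y x = 0) -> h m x = 0.
Proof.
move=> /memv_imgP[y _ ->] xb sx; rewrite M_adj // big1 ?oppr0 // => i _.
by rewrite sx (inn0r hI).
Qed.
Let E_perpP x : x \in b ->
  (forall y, y \in b -> (forall z, s z y = 0) -> h x y = 0) -> x \in E.
Proof.
move=> xb px; have [w [m [wW mE xwm]]] := decomp x.
have wb : w \in b by rewrite -(addrK m w) -xwm memvB // E_b.
have sw : forall z, s z w = 0.
  by apply: M_ker => //; move: wW; rewrite memv_ker => /eqP.
suff -> : x = m by [].
rewrite xwm (_ : w = 0) ?add0r //; apply: (inn_eq0 hI).
have -> : h w w = h (w + m) w by rewrite (innDl hI) (E_perp mE) // addr0.
by rewrite -xwm px.
Qed.

(** On W the SKT identity equates three squares with 2 h(s(x, x), s(y, y)). Let y run through the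
    projections f_i of the e_i to W, and let T be the sum of the s(f_i, f_i). The balanced sum is T
    plus terms s(f_i, m) with m in E; these are orthogonal to T, which is killed by all s(y, .) and
    hence by all c(y, .). So T = 0, and the squares vanish. *)
Let W_flat w w' : w \in W -> w' \in W -> c w w' = 0 /\ s w w' = 0.
Proof.
move=> wW w'W.
have sq x y : x \in W -> y \in W ->
    h (c x y) (c x y) + h (s y x) (s y x) + h (s x y) (s x y)
    = 2 * h (s x x) (s y y).
  move=> xW yW; have := sk_skt SB x y; rewrite /skt_form (W_sbcb _ xW yW).
  rewrite (cbC CL (s y x)) (cbC CL (s y y)) !W_cbsb // !(sb0 _ (sb_b _ _)).
  by rewrite !(oppr0, inn0l hI); lra.
pose p := daddv_pi W E.
have pW x : p x \in W by exact: memv_pi.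
have pE x : x - p x \in E.
  have xE : p x + daddv_pi E W x = x by apply: daddv_pi_add; rewrite ?WE_full ?memvf.
  by rewrite -{1}xE addrC addKr memv_pi.
have p_id x : x \in W -> p x = x by exact: daddv_pi_id.
pose f i := p (e i); pose T := \sum_i s (f i) (f i).
have Ts y : s y T = 0.
  by rewrite /T (bil_sumr sB) big1 // => i _; apply: W_sb (pW _).
have Tb : T \in b by apply: memv_suml.
have T0 : T = 0.
  have eE i : s (e i) (e i) = s (f i) (f i) + s (f i) (e i - f i).
    rewrite -(bilDr sB) addrCA subrr addr0.
    by rewrite -{1}(subrK (f i) (e i)) (bilDl sB) sb0 ?add0r // E_b.
  have : \sum_i (s (f i) (f i) + s (f i) (e i - f i)) = 0.
    by rewrite -[RHS](sk_bal SB); apply: eq_bigr => i _; rewrite eE.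
  rewrite big_split /= -/T => TT; apply: (inn_eq0 hI).
  have -> : h T T = h T (T + \sum_i s (f i) (e i - f i)).
    rewrite (innDr hI) (inn_sumr hI) big1 ?addr0 // => i _.
    have := adj (f i) Tb (E_b (pE (e i))).
    by rewrite (cb_ker _ Tb Ts) (inn0l hI) => /esym/eqP; rewrite oppr_eq0 => /eqP.
  by rewrite TT (inn0r hI).
have key x i : x \in W -> c x (f i) = 0 /\ s x (f i) = 0.
  move=> xW; have : \sum_i (h (c x (f i)) (c x (f i)) + h (s (f i) x) (s (f i) x)
    + h (s x (f i)) (s x (f i))) = 0.
    rewrite (eq_bigr _ (fun i _ => sq x (f i) xW (pW _))) -mulr_sumr.
    by rewrite -(inn_sumr hI) -/T T0 (inn0r hI) mulr0.
  have q0 := inn_ge0 hI.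
  move/psumr_eq0P => /(_ (fun j _ => addr_ge0 (addr_ge0 (q0 _) (q0 _)) (q0 _)) i isT).
  move: (q0 (c x (f i))) (q0 (s (f i) x)) (q0 (s x (f i))) => p1 p2 p3 H.
  by split; apply: (inn_eq0 hI); lra.
rewrite -(p_id _ w'W); move: w' {w'W}; apply: (span_ind SB).
- by rewrite linear0 (bil0r cB) (bil0r sB).
- by move=> k x y [cx sx] [cy sy]; rewrite linearP cB.2 sB.2 cx cy sx sy scaler0 addr0.
by move=> i; apply: key.
Qed.

Let br_W w w' : w \in W -> w' \in W -> br w w' = 0.
Proof.
move=> wW w'W; have [cw sw] := W_flat wW w'W; have [_ sw'] := W_flat w'W wW.
have := brE CL w w'; rewrite cw sw sw' addr0 subr0 -scaler_nat => /eqP.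
by rewrite scaler_eq0 pnatr_eq0 => /eqP.
Qed.

(** An x in [b] killed by all s(z, .) is killed by all c(z, .) too. By the adjunction, c(y, m) and
    s(y, m) are orthogonal to every such x, and their sum is 2[y, m]. *)
Let br_E y m : m \in E -> br y m \in E.
Proof.
move=> mE; have mb := E_b mE.
have : c y m + s y m \in E.
  rewrite memvD //; apply: E_perpP => // x xb sx.
    by rewrite adj // sx (inn0r hI) oppr0.
  rewrite (innC hI); have := adj y xb mb; rewrite (cb_ker _ xb sx) (inn0l hI).
  by move=> /esym/eqP; rewrite oppr_eq0 => /eqP.
have -> : c y m + s y m = br y m *+ 2 by rewrite (brE CL) (sb0 _ mb) subr0.
move=> /(memvZ 2%:R^-1).
by rewrite -scaler_nat scalerA mulVf ?pnatr_eq0 // scale1r.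
Qed.

Let der_E : a = E.
Proof.
apply/eqP; rewrite eqEsubv; apply/andP; split; last first.
  by apply/subvP => m /E_derJ; apply: der_J_a.
apply: lie_der_sub => x y.
have [w [m [wW mE ->]]] := decomp x; have [w' [m' [w'W m'E ->]]] := decomp y.
rewrite (bilDl B) (bilDr B) br_W // add0r memvD //; first exact: br_E.
by rewrite (brC CL) memvN br_E.
Qed.

Lemma flat_splitting0 :
  [/\ forall x, x \in a -> J x \in a,
      forall x y, y \in a -> br x (J y) = J (br x y),
      forall x y y', y \in a -> y' \in a -> h (br x y) y' = - h y (br x y') &
      exists W, [/\ (W + a = fullv)%VS, (W :&: a = 0)%VS,
        forall x, x \in W -> J x \in W &
        forall x y, x \in W -> y \in W -> br x y = 0]].
Proof.
have aJE x : x \in a -> x \in aJ by rewrite der_E => /E_derJ.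
split.
- by move=> x /aJE; apply: (der_JJa CL).
- by case: span_facts => _ _ _ H _ x y /aJE yJ; apply: H.
- by case: span_facts => _ _ _ _ H x y y' /aJE ya /aJE y'a; apply: H.
by exists W; rewrite der_E; split.
Qed.

End Laplacian.

Lemma flat_splitting :
  [/\ forall x, x \in a -> J x \in a,
      forall x y, y \in a -> br x (J y) = J (br x y),
      forall x y y', y \in a -> y' \in a -> h (br x y) y' = - h y (br x y') &
      exists W, [/\ (W + a = fullv)%VS, (W :&: a = 0)%VS,
        forall x, x \in W -> J x \in W &
        forall x y, x \in W -> y \in W -> br x y = 0]].
Proof. by have [M ME] := M_exists; apply: flat_splitting0 ME. Qed.

End Flat.

(** * Reduction to that case *)

Section Reduction.
Context {R : rcfType} {g : vectType R}.
Implicit Types (x y w : g) (U W : {vspace g}).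
Context (br : g -> g -> g) (J : 'End(g)) (h : g -> g -> R) (n : nat) (e : 'I_n -> g).
Hypothesis SB : skt_balanced br J h e.
Local Notation c := (cb br J).
Local Notation s := (sb br J).
Local Notation a := (lie_der br).
Local Notation aJ := (der_J br J).
Let CL := sk_cl SB.
Let hI := sk_inner SB.
Let B := cl_bilin CL.
Let JJ := cl_JJ CL.
Let JD x y : J (x + y) = J x + J y. Proof. exact: linearD. Qed.

Section OneElement.
Context (z : g) (za : z \in a).
Let D x := br (J z) x.

Lemma iter_adD k x y : iter k D (x + y) = iter k D x + iter k D y.
Proof. by elim: k => //= k ->; rewrite /D (bilDr B). Qed.
Lemma iter_ad0 k : iter k D 0 = 0.
Proof. by elim: k => //= k ->; rewrite /D (bil0r B). Qed.
Lemma iter_adZ k t x : iter k D (t *: x) = t *: iter k D x.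
Proof. by elim: k => //= k ->; rewrite /D (bilZr B). Qed.
Lemma iter_ad_comm k y x : x \in a -> iter k D (br y x) = br y (iter k D x).
Proof.
move=> xa; elim: k => //= k ->; rewrite /D (ad_comm CL (J z)) //.
by case: k => //= k; rewrite (mem_br CL).
Qed.

Let skew x x' : x \in aJ -> x' \in aJ -> h (D x) x' = - h x (D x').
Proof. exact: (adJ_skew SB za). Qed.
Let D_derJ x : x \in aJ -> D x \in aJ. Proof. exact: adJ_mem. Qed.

Let DD0 x : x \in aJ -> D (D x) = 0 -> D x = 0.
Proof.
move=> xJ DDx; apply: (inn_eq0 hI).
by rewrite skew ?D_derJ // DDx (inn0r hI) oppr0.
Qed.
Let iterD0 k x : x \in aJ -> iter k D x = 0 -> D x = 0.
Proof.
elim: k x => [|k IH] x xJ; first by move=> /= ->; rewrite /D (bil0r B).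
rewrite iterSr => /IH DD; apply: DD0 => //; apply: DD; exact: D_derJ.
Qed.

Context (f : 'End(g)) (fE : forall x, f x = D x).
(** As D is skew on [aJ], this is the orthogonal complement of its kernel there, and D is bijective
    on it. *)
Let F := (f @: aJ)%VS.

Let FP x : x \in F <-> exists2 u, u \in aJ & x = D u.
Proof.
split=> [/memv_imgP[u uJ ->]|[u uJ ->]]; first by exists u; rewrite ?fE.
by rewrite -fE memv_img.
Qed.
Let F_derJ x : x \in F -> x \in aJ.
Proof. by move=> /FP[u uJ ->]; apply: D_derJ. Qed.
Let F_der x : x \in F -> x \in a. Proof. by move=> /F_derJ/(der_J_a CL). Qed.
Let F_J x : x \in F -> J x \in F.
Proof.
move=> /FP[u uJ ->]; apply/FP; exists (J u); first exact: der_JJ.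
by rewrite /D (adJ_J CL za uJ).
Qed.
Let F_inj k x : x \in F -> iter k D x = 0 -> x = 0.
Proof.
move=> xF /(iterD0 (F_derJ xF)).
by case/FP: xF => u uJ ->; apply: DD0.
Qed.
Let F_surj k x : x \in F -> exists2 y, y \in F & iter k D y = x.
Proof.
elim: k x => [|k IH] x xF; first by exists x.
have [y yF <-] := IH x xF.
have FF : (f @: F <= F)%VS.
  by apply/subvP => _ /memv_imgP[u uF ->]; rewrite fE; apply/FP; exists u; rewrite ?F_derJ.
have Fi u : u \in F -> f u = 0 -> u = 0 by rewrite fE; apply: (F_inj (k := 1)).
have [w wF wy] := lfun_inj_surj FF Fi yF.
by exists w => //; rewrite iterSr -fE wy.
Qed.

Context (m : nat) (nil : forall x, x \in a -> iter m D x \in aJ).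

(** Of the m + 2 applications of D, the first leads into [a], the next m into [aJ], and the last
    into [F]. *)
Let iter_F x : iter m.+2 D x \in F.
Proof. by rewrite iterS iterSr; apply/FP; exists (iter m D (D x)); rewrite ?nil ?(mem_br CL). Qed.

(** A vector w of [F] can be subtracted from z without changing ad(Jz) on [a]. With z itself in the
    generalized kernel of D, that kernel becomes J-stable; see [G0_J]. *)
Lemma ad_lift_nil : exists2 z0, z0 \in a &
  (forall x, x \in a -> br (J z0) x = br (J z) x) /\ exists k, iter k (br (J z0)) z0 = 0.
Proof.
have [w wF wE] := F_surj m.+2 (iter_F z).
have zwa : z - w \in a by rewrite memvB // F_der.
have E x : x \in a -> br (J (z - w)) x = br (J z) x.
  move=> xa; rewrite linearB /= (bilBl B) (adJ_derJ CL (F_derJ wF) xa) subr0 //.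
exists (z - w) => //; split=> //; exists m.+2.
have -> : iter m.+2 (br (J (z - w))) (z - w) = iter m.+2 D (z - w).
  elim: m.+2 => //= k ->; rewrite E //.
  by case: k => //= k; rewrite (mem_br CL).
by rewrite iter_adD -scaleN1r iter_adZ wE scaleN1r subrr.
Qed.

Hypothesis zz : exists k, iter k D z = 0.

Let G0 x := exists k, iter k D x = 0.

Let G0_sub x : G0 (D x) -> G0 x.
Proof. by move=> [k]; rewrite -iterSr; exists k.+1. Qed.
Let G0_D x : G0 x -> G0 (D x).
Proof. by move=> [k kx]; exists k; rewrite -iterSr iterS kx /D (bil0r B). Qed.
Let iter_more k l x : iter k D x = 0 -> iter (l + k) D x = 0.
Proof. by move=> kx; rewrite iterD kx iter_ad0. Qed.
Let G0_lin t x y : G0 x -> G0 y -> G0 (t *: x + y).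
Proof.
move=> [k kx] [l ly]; exists (k + l)%N.
by rewrite iter_adD iter_adZ addnC iter_more // addnC iter_more // scaler0 addr0.
Qed.
Let G0_0 : G0 0. Proof. by exists 0%N. Qed.
Let G0_N x : G0 x -> G0 (- x).
Proof. by move=> /(G0_lin (-1))/(_ G0_0); rewrite scaleN1r addr0. Qed.
Let G0_add x y : G0 x -> G0 y -> G0 (x + y).
Proof. by move=> /(G0_lin 1) H /H; rewrite scale1r. Qed.
Let G0_br x y : G0 x -> G0 y -> G0 (br x y).
Proof.
move=> [k kx] [l ly]; exists (k + l)%N.
move: {2}(k + l)%N (leqnn (k + l)) => d; elim: d k l x y kx ly => [|d IH] k l x y kx ly.
  rewrite leqn0 addn_eq0 => /andP[/eqP k0 _]; move: kx; rewrite k0 /= => ->.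
  by rewrite (bil0l B) iter_ad0.
case: k kx => [/= ->|k kx]; first by rewrite (bil0l B) iter_ad0.
case: l ly => [ly|l ly] le; first by rewrite (ly : y = 0) (bil0r B) iter_ad0.
rewrite addSn iterSr {2}/D (br_der CL) iter_adD.
have kx' : iter k D (D x) = 0 by rewrite -iterSr.
have ly' : iter l D (D y) = 0 by rewrite -iterSr.
have le1 : (k + l.+1 <= d)%N by lia.
have le2 : (k.+1 + l <= d)%N by lia.
by rewrite (IH k l.+1) // add0r addnS -addSn (IH k.+1 l).
Qed.
Let G0_ad y x : x \in a -> G0 x -> G0 (br y x).
Proof. by move=> xa [k kx]; exists k; rewrite iter_ad_comm // kx (bil0r B). Qed.
(** D(Jx) = Jt, where t lies in [aJ] and in the generalized kernel, thus in the kernel of D because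
    D is skew on [aJ]. Hence D(D(Jx)) = J(Dt) = 0. *)
Let G0_Ja x : x \in a -> G0 x -> G0 (J x).
Proof.
move=> xa xG; pose t := D x - br (J x) z.
have tJ : t \in aJ by apply: J_br_sub.
have tG : G0 t by apply: G0_add; [apply: G0_D|apply: G0_N; apply: G0_ad].
have Dt : D t = 0 by case: tG => k /(iterD0 tJ).
apply: G0_sub; apply: G0_sub; exists 0%N => /=.
suff -> : D (J x) = J t by rewrite /D (adJ_J CL za tJ) -/(D t) Dt linear0.
rewrite /t /D (brJJ CL) (br_der0 CL za xa) add0r -JD.
by rewrite (brC CL z).
Qed.
Let G0_J x : G0 x -> G0 (J x).
Proof.
move=> xG; apply: G0_sub; rewrite /D (brJJ CL).
have zxG y : G0 (br z y) by rewrite (brC CL); apply: G0_N; apply: G0_ad.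
apply: G0_add; first apply: G0_add => //.
  by apply: G0_Ja; [exact: mem_br CL _ _|apply: G0_D].
by apply: G0_Ja; [exact: mem_br CL _ _|].
Qed.

Context (G : {vspace g}) (GP : forall x, x \in G <-> G0 x).

Let GF_cap : (G :&: F = 0)%VS.
Proof.
apply/eqP; rewrite -subv0; apply/subvP => x; rewrite memv_cap memv0 => /andP[/GP[k kx] xF].
by rewrite (F_inj xF kx).
Qed.
Let GF_full x : x \in (G + F)%VS.
Proof.
have [y yF yE] := F_surj m.+2 (iter_F x).
rewrite -(subrK y x) memv_add //; apply/GP; exists m.+2.
by rewrite iter_adD -scaleN1r iter_adZ yE scaleN1r subrr.
Qed.

Let pi := daddv_pi G F.
Let rho := daddv_pi F G.
Let piG x : pi x \in G. Proof. exact: memv_pi. Qed.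
Let rhoF x : rho x \in F. Proof. exact: memv_pi. Qed.
Let pi_rho x : pi x + rho x = x. Proof. exact: daddv_pi_add. Qed.
Let pi_id x : x \in G -> pi x = x. Proof. exact: daddv_pi_id. Qed.
Let rho_id x : x \in F -> rho x = x.
Proof. by apply: daddv_pi_id; rewrite capvC. Qed.
Let rho0 x : x \in G -> rho x = 0.
Proof.
by move=> xG; have := pi_rho x; rewrite pi_id // => /(canRL (addKr _)) ->; rewrite addNr.
Qed.
Let pi0 x : x \in F -> pi x = 0.
Proof.
by move=> xF; have := pi_rho x; rewrite rho_id // => /(canRL (addrK _)) ->; rewrite subrr.
Qed.
Let piE x y : y \in F -> pi (x + y) = pi x.
Proof. by move=> yF; rewrite linearD /= (pi0 yF) addr0. Qed.
Let G_J x : x \in G -> J x \in G.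
Proof. by move=> /GP xG; apply/GP; apply: G0_J. Qed.
Let pi_J x : pi (J x) = J (pi x).
Proof.
by rewrite -{1}(pi_rho x) JD (piE _ (F_J (rhoF x))) (pi_id (G_J (piG x))).
Qed.
Let rho_J x : rho (J x) = J (rho x).
Proof.
rewrite -{1}(pi_rho x) JD linearD /= (rho0 (G_J (piG x))) add0r.
by rewrite (rho_id (F_J (rhoF x))).
Qed.
(** On [a], ad x commutes with D. So y = D^(m+1) w gives [x, y] = D^(m+1) [x, w], which lies in
    D(aJ). *)
Let F_ideal x y : y \in F -> br x y \in F.
Proof.
move=> yF; have [w wF <-] := F_surj m.+1 yF.
rewrite -(iter_ad_comm _ _ (F_der wF)) iterS; apply/FP.
exists (iter m D (br x w)) => //.
by apply: nil; exact: mem_br CL _ _.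
Qed.
Let G_br x y : x \in G -> y \in G -> br x y \in G.
Proof. by move=> /GP xG /GP yG; apply/GP; apply: G0_br. Qed.
Let pi_br x y : pi (br x y) = br (pi x) (pi y).
Proof.
have rF : br (rho x) y \in F by rewrite (brC CL) memvN F_ideal.
rewrite -{1}(pi_rho x) (bilDl B) (piE _ rF) -{1}(pi_rho y) (bilDr B).
by rewrite (piE _ (F_ideal _ (rhoF y))) (pi_id (G_br (piG x) (piG y))).
Qed.

(** The Lie algebra G extended by [F] as a central abelian summand; [red_inn] makes the two summands
    orthogonal. *)
Definition red_br x y := br (pi x) (pi y).
Definition red_inn x y := h (pi x) (pi y) + h (rho x) (rho y).

Let red_CL : complex_lie red_br J.
Proof.
split.
- by split=> k x y w; rewrite /red_br linearP (B.1, B.2).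
- by move=> x; apply: (cl_alt CL).
- move=> x y w; rewrite /red_br !pi_br !(pi_id (piG _)); exact: (cl_jac CL).
- by move=> x y w t; rewrite /red_br !pi_br; exact: (cl_meta CL).
- exact: JJ.
by move=> x y; rewrite /red_br !pi_J; exact: (cl_nij CL).
Qed.

Let red_cb x y : cb red_br J x y = c (pi x) (pi y).
Proof. by rewrite !cb.unlock /red_br !pi_J. Qed.
Let red_sb x y : sb red_br J x y = s (pi x) (pi y).
Proof. by rewrite !sb.unlock /red_br !pi_J. Qed.
Let cbG x y : x \in G -> y \in G -> c x y \in G.
Proof.
move=> xG yG; rewrite cb.unlock memvB ?G_br //; by apply: G_J.
Qed.
Let sbG x y : x \in G -> y \in G -> s x y \in G.
Proof.
move=> xG yG; rewrite sb.unlock memvD ?G_br //; apply: G_J; apply: G_br => //.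
by apply: G_J.
Qed.

Lemma red_inner : inner red_inn.
Proof.
split=> [k x y w|x y|x x0].
- by rewrite /red_inn !linearP /= !(innDl hI) !(innZl hI); ring.
- by rewrite /red_inn (innC hI) (innC hI (rho x)).
rewrite lt_neqAle addr_ge0 ?(inn_ge0 hI) // andbT eq_sym.
apply: contra x0 => /eqP; rewrite /red_inn => H.
have p0 : pi x = 0 by apply: (inn_eq0 hI); move: H (inn_ge0 hI (pi x)) (inn_ge0 hI (rho x)); lra.
have r0 : rho x = 0 by apply: (inn_eq0 hI); move: H (inn_ge0 hI (pi x)) (inn_ge0 hI (rho x)); lra.
by rewrite -(pi_rho x) p0 r0 addr0.
Qed.

Let red_innG x y : x \in G -> red_inn x y = h x (pi y).
Proof. by move=> xG; rewrite /red_inn pi_id // rho0 // (inn0l hI) addr0. Qed.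

(** The SKT identity is the old one at (pi x, pi y), since G is a J-stable subalgebra on which the
    metric is still h. The balanced sum is the image of the old one under the homomorphism [pi]. *)
Lemma red_skt : skt_balanced red_br J red_inn e.
Proof.
split.
- exact: red_CL.
- exact: red_inner.
- by move=> x y; rewrite /red_inn !pi_J !rho_J !(sk_compat SB).
- move=> x y; rewrite -(sk_skt SB (pi x) (pi y)) /skt_form !red_cb !red_sb.
  have [gc gs] : (forall u v, pi (c (pi u) (pi v)) = c (pi u) (pi v)) /\
      (forall u v, pi (s (pi u) (pi v)) = s (pi u) (pi v)).
    by split=> u v; rewrite pi_id ?cbG ?sbG.
  rewrite !gc !gs !red_innG ?cbG ?sbG ?gc ?gs //.
  exact: cbG.
- have E i : sb red_br J (e i) (e i) = pi (s (e i) (e i)).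
    by rewrite red_sb !sb.unlock linearD /= !(pi_J, pi_br).
  by under eq_bigr do rewrite E; rewrite -linear_sum (sk_bal SB) linear0.
exact: (sk_span SB).
Qed.

Lemma red_der_sub : (lie_der red_br <= a)%VS.
Proof. by apply: lie_der_sub => x y; apply: mem_br CL _ _. Qed.

(** D x lies in [a] and in [F], whereas the new derived algebra lies in G. *)
Lemma red_der_dim x : x \in aJ -> D x != 0 -> (\dim (lie_der red_br) < \dim a)%N.
Proof.
move=> xJ Dx; rewrite ltn_neqAle dimvS ?red_der_sub // andbT.
apply: contra Dx => dE; have E : lie_der red_br = a.
  by apply/eqP; rewrite eqEdim red_der_sub (eqP dE) leqnn.
have aG : (a <= G)%VS by rewrite -E; apply: lie_der_sub => u v; apply: G_br.
have : D x \in (G :&: F)%VS.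
  by rewrite memv_cap (subvP aG) ?(mem_br CL) //; apply/FP; exists x.
by rewrite GF_cap memv0.
Qed.

Lemma red_der_J : (forall x, x \in lie_der red_br -> J x \in lie_der red_br) ->
  forall x, x \in a -> J x \in a.
Proof.
move=> H x; move: x; apply: (@der_ind _ _ br (fun x => J x \in a)); first by rewrite linear0 mem0v.
  by move=> k x y xa ya; rewrite linearP memvD ?memvZ.
move=> x y; rewrite -(pi_rho (br x y)) JD memvD //; last by apply/F_der/F_J.
rewrite pi_br; apply: (subvP red_der_sub); apply: H; exact: (mem_br red_CL).
Qed.

End OneElement.
End Reduction.

(** * Induction on the dimension of the derived algebra *)

Section Vanishing.
Context {R : rcfType} {g : vectType R}.

Lemma adJ_zero (br : g -> g -> g) (J : 'End(g)) (h : g -> g -> R) n (e : 'I_n -> g) :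
  skt_balanced br J h e ->
  forall z x, z \in lie_der br -> x \in der_J br J -> br (J z) x = 0.
Proof.
move: {2}(\dim (lie_der br)).+1 (ltnSn (\dim (lie_der br))) => d.
elim: d br h => // d IH br h; rewrite ltnS => dle SB z x za xJ.
have CL := sk_cl SB.
have [//|Dx] := eqVneq (br (J z) x) 0.
have [m nil] := adJ_nilpotent SB za.
have [f fE] := lfun_of (fun k u v => (cl_bilin CL).2 k u v (J z)).
have [z0 z0a [z0E [k z0k]]] := ad_lift_nil SB za fE nil.
have [f0 f0E] := lfun_of (fun k u v => (cl_bilin CL).2 k u v (J z0)).
have nil0 y : y \in lie_der br -> iter m (br (J z0)) y \in der_J br J.
  move=> ya; suff -> : iter m (br (J z0)) y = iter m (br (J z)) y by apply: nil.
  elim: m {nil} => //= i ->; rewrite z0E //.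
  by case: i => //= i; rewrite (mem_br CL).
have [G GP] : exists G : {vspace g}, forall y, y \in G <-> exists k, iter k (br (J z0)) y = 0.
  apply: vspace_of_pred; first by exists 0%N.
  move=> t u v [i ui] [j vj]; exists (i + j)%N.
  rewrite (iter_adD SB) (iter_adZ SB) addnC iterD ui (iter_ad0 SB) scaler0 add0r.
  by rewrite addnC iterD vj (iter_ad0 SB).
have Dx0 : br (J z0) x != 0 by rewrite z0E // (der_J_a CL).
have SB' := red_skt SB z0a f0E nil0 (ex_intro _ k z0k) GP.
have lt' := red_der_dim SB z0a f0E GP xJ Dx0.
have adJ0' := IH _ _ (leq_trans lt' dle) SB'.
have [aJ' _ _ _] := flat_splitting SB' adJ0'.
have aJ := red_der_J SB z0a f0E nil0 (ex_intro _ k z0k) GP aJ'.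
by apply: (br_der0 CL); [apply: aJ|apply: (der_J_a CL)].
Qed.

End Vanishing.

(** * The SKT condition *)

Section ChevalleyEilenberg.
Context {R : realType} {g : vectType R} (br : {bilinear g -> g -> g}).

Definition tup k (t : seq g) : g ^ k := [ffun i : 'I_k => nth 0 t i].

Lemma ce_diff2 (A : g -> g -> R) (a : kform 2) x y z :
  (forall t : g ^ 2, a t = A (t ord0) (t ord_max)) ->
  ce_diff br a (tup 3 [:: x; y; z]) = - A (br x y) z + A (br x z) y - A (br y z) x.
Proof.
move=> aE; rewrite /ce_diff.
under eq_bigr => i _ do rewrite big_mkcond.
rewrite !big_ord_recl !big_ord0 /= !aE /ce_args /tup !ffunE /= !inordK //.
rewrite /bump /= !(addSn, add0n) !(exprS, expr0).
by ring.
Qed.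

Lemma ce_diff3 (A : g -> g -> g -> R) (a : kform 3) x y z w :
  (forall t : g ^ 3, a t = A (t ord0) (t (inord 1)) (t ord_max)) ->
  ce_diff br a (tup 4 [:: x; y; z; w]) =
    - A (br x y) z w + A (br x z) y w - A (br x w) y z
    - A (br y z) x w + A (br y w) x z - A (br z w) x y.
Proof.
move=> aE; rewrite /ce_diff.
under eq_bigr => i _ do rewrite big_mkcond.
rewrite !big_ord_recl !big_ord0 /=.
rewrite !aE /ce_args /tup.
rewrite !ffunE /=.
rewrite !inordK //=.
rewrite /bump /= !(addSn, add0n) !(exprS, expr0).
by ring.
Qed.
Context (J : 'End(g)) (h : {dot g for idfun}).

Lemma bilin_bilinear : bilin br.
Proof.
split=> k x y z; first by rewrite linearDl /= linearZl_LR.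
by rewrite linearDr /= linearZr_LR.
Qed.

Lemma inner_dot : inner h.
Proof.
split=> [k x y z|x y|x x0].
- by rewrite linearDl /= linearZl_LR.
- by rewrite (hermC h x y) expr0 mul1r.
- exact: neq0_dnorm_gt0.
Qed.

Lemma complex_lie_of : lie_bracket br -> two_step_solvable br ->
  complex_structure br J -> complex_lie br J.
Proof.
move=> [alt jac] st [JJ nij]; split=> // [|x y z w]; first exact: bilin_bilinear.
have br_der u v : br u v \in derived_alg br.
  by have /bracketvP := subvv (derived_alg br); apply; apply: memvf.
have /bracketvP H : (bracketv br (derived_alg br) (derived_alg br) <= 0)%VS.
  by rewrite (st : bracketv _ _ _ = _).
by apply/eqP; rewrite -memv0 H.
Qed.

Hypotheses (CL : complex_lie br J) (hJ : J_compatible J h).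
Let hI := inner_dot.
Let B := cl_bilin CL.
Let JJ := cl_JJ CL.

Lemma J_invE x : (J^-1)%VF x = - J x.
Proof.
have Ji : injective J by move=> u v /(congr1 J); rewrite !JJ; exact: oppr_inj.
by apply: (canLR (lker0_lfunK _)); [apply/lker0P|rewrite linearN /= JJ opprK].
Qed.

Local Notation c := (cb br J).
Local Notation s := (sb br J).

Let dcF x y z := h (br (J x) (J y)) z - h (br (J x) (J z)) y + h (br (J y) (J z)) x.

Lemma dc_fund (t : g ^ 3) : dc br J (fund_form J h) t =
  dcF (t ord0) (t (inord 1)) (t ord_max).
Proof.
rewrite /dc /form_pull; set t' := [ffun i => _].
have -> : t' = tup 3 [:: - J (t ord0); - J (t (inord 1)); - J (t ord_max)].
  apply/ffunP => i; rewrite !ffunE J_invE.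
  case: i => -[|[|[|//]]] /= lti; congr (- J (t _)); apply/val_inj => //=.
  by rewrite inordK.
(* The pullback of omega by J takes (u, v) to h(JJu, Jv) = - h(u, Jv). *)
rewrite (@ce_diff2 (fun u v => - h u (J v))); last first.
  by move=> u; rewrite /fund_form !ffunE JJ (innNl hI).
rewrite /dcF !(bilNl B, bilNr B, innNr hI, innNl hI) !opprK !linearN /= !JJ.
by rewrite !(innNr hI) !opprK; ring.
Qed.

Lemma skt_dd x y z w : skt br J h ->
  - dcF (br x y) z w + dcF (br x z) y w - dcF (br x w) y z
    - dcF (br y z) x w + dcF (br y w) x z - dcF (br z w) x y = 0.
Proof. by move=> /(_ (tup 4 [:: x; y; z; w])) <-; rewrite (ce_diff3 _ _ _ _ dc_fund). Qed.

(** In dd^c omega at (x, Jx, y, Jy), all brackets are expressed by c and s, whose types allow J to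
    be moved out of every argument. *)
Lemma skt_form_skt x y : skt br J h -> skt_form br J h x y = 0.
Proof.
move=> /(skt_dd x (J x) y (J y)).
have cB := cb_bilin CL; have sB := sb_bilin CL.
have JD u v : J (u + v) = J u + J v by exact: linearD.
have JN u : J (- u) = - J u by exact: linearN.
have JZ k u : J (k *: u) = k *: J u by exact: linearZ.
have bE u v : br u v = 2^-1 *: (c u v + s u v - s v u).
  by rewrite -(brE CL) -scaler_nat scalerA mulVf ?scale1r ?pnatr_eq0.
have hJr u v : h u (J v) = - h (J u) v by rewrite -hJ JJ (innNr hI).
have cxx u : c u u = 0 by rewrite cb.unlock !(cl_alt CL) subrr.
have brxJ u : br u (J u) = J (s u u).
  by rewrite (sb_self CL) JN JJ opprK.
have brxJy u v : br u (J v) = 2^-1 *: J (c u v + s u v + s v u).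
  by rewrite bE (cbJr CL) (sbJr CL) (sbJl CL) opprK !JD.
have brJxy u v : br (J u) v = 2^-1 *: J (c u v - s u v - s v u).
  by rewrite bE (cbJl CL) (sbJl CL) (sbJr CL) !(JD, JN).
have brJxJy u v : br (J u) (J v) = 2^-1 *: (s u v - c u v - s v u).
  rewrite bE (cbJl CL) (cbJr CL) JJ (sbJl CL) (sbJr CL) (sbJl CL) (sbJr CL) !JJ !opprK.
  by rewrite (addrC (- c u v)).
have dcl k p q u v : dcF (k *: p + q) u v = k * dcF p u v + dcF q u v.
  rewrite /dcF JD JZ !(bilDl B, bilDr B, bilZl B, bilZr B).
  by rewrite !(innDl hI, innDr hI, innZl hI, innZr hI); ring.
have dcD p q u v : dcF (p + q) u v = dcF p u v + dcF q u v.
  by have := dcl 1 p q u v; rewrite scale1r mul1r.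
have dc0 u v : dcF 0 u v = 0.
  by have := dcD 0 0 u v; rewrite addr0; lra.
have dcZ k p u v : dcF (k *: p) u v = k * dcF p u v.
  by have := dcl k p 0 u v; rewrite addr0 dc0 addr0.
have dcN p u v : dcF (- p) u v = - dcF p u v by rewrite -scaleN1r dcZ mulN1r.
have dcE p u v : 2 * dcF p u v =
    h (s p u) v - h (c p u) v - h (s u p) v - h (s p v) u + h (c p v) u + h (s v p) u
    + h (s u v) p - h (c u v) p - h (s v u) p.
  rewrite /dcF !brJxJy !(innZl hI) !(innDl hI, innNl hI).
  have n2 : (2 : R) != 0 by rewrite pnatr_eq0.
  by field.
have hN := (innNl hI, innNr hI).
have hJJ u v : h (J u) (J v) = h u v by exact: hJ.
have Jr := (cbJl CL, cbJr CL, sbJl CL, sbJr CL, JN, JJ, hN, hJJ, hJr).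
have A1 p : 2 * dcF p (J x) (J y) =
    h (s p x) y - h (c p x) y + h (s x p) y - h (s p y) x + h (c p y) x - h (s y p) x
    + h (s x y) p + h (c x y) p - h (s y x) p.
  by rewrite dcE !Jr; ring.
have A2 p : 2 * dcF (J p) (J x) y =
    h (s p x) y + h (c p x) y - h (s x p) y + h (s p y) x + h (c p y) x + h (s y p) x
    - h (s x y) p - h (c x y) p - h (s y x) p.
  by rewrite dcE !Jr; ring.
have A3 p : 2 * dcF (J p) x (J y) =
    - h (s p x) y - h (c p x) y - h (s x p) y - h (s p y) x - h (c p y) x + h (s y p) x
    + h (s x y) p - h (c x y) p + h (s y x) p.
  by rewrite dcE !Jr; ring.
have A4 p u : dcF (J p) u (J u) = h (s u u) p - h (s p u) u - h (c p u) u.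
  by have := dcE (J p) u (J u); rewrite !Jr cxx (inn0l hI); lra.
(* The double brackets of the expansion are related by the Jacobi identity, here paired with x and
   with y. *)
have m1 := congr1 (h^~ x) (sb_cb CL y x y); have m2 := congr1 (h^~ y) (sb_cb CL x x y).
rewrite /= (cbC CL x (s y y)) !(innDl hI, hN) in m1.
rewrite /= (cbC CL x (s x y)) !(innDl hI, hN) in m2.
rewrite !brxJ !A4 (brxJy x y) (brJxy x y) (brJxJy x y) bE.
rewrite !dcZ !(JD, JN) !(dcD, dcN) /skt_form.
move: (A1 (c x y)) (A1 (s x y)) (A1 (s y x)) (A2 (c x y)) (A2 (s x y)) (A2 (s y x)).
move: (A3 (c x y)) (A3 (s x y)) (A3 (s y x)) (dcE (c x y) x y) (dcE (s x y) x y) (dcE (s y x) x y).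
rewrite (innC hI (s y y)) (innC hI (s y x) (s x y)) (innC hI (c x y)) (innC hI (c x y) (s y x)).
move=> *; lra.
Qed.
End ChevalleyEilenberg.

(** * The balanced condition *)

Section Forms.
Context {R : realType} {g : vectType R} (w : g -> g -> R) (a : kform (g:=g) 2).
Hypothesis aE : forall t : g ^ 2, a t = w (t ord0) (t ord_max).

Local Notation eta k := (wedge_pow a k).
Local Notation o0 m := (lshift m (@ord0 1)).
Local Notation o1 m := (lshift m (@ord_max 1)).

Lemma wedge_powS k (x : g ^ (2 + k.*2)) : eta k.+1 x =
  (2`! * (k.*2)`!)%:R^-1 * \sum_(s : 'S_(2 + k.*2))
    (-1) ^+ s * (w (x (s (o0 _))) (x (s (o1 _))) * eta k [ffun i => x (s (rshift 2 i))]).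
Proof.
rewrite /= /wedge; congr (_ * _); apply: eq_bigr => s _.
by rewrite aE !ffunE.
Qed.

(** Fully expanded, the power is a polynomial in the values w(x_i, x_j). *)
Lemma wedge_pow_gram k (x y : g ^ k.*2) :
  (forall i j, w (x i) (x j) = w (y i) (y j)) -> eta k x = eta k y.
Proof.
elim: k x y => [//|k IH] x y xy; rewrite !wedge_powS; congr (_ * _).
apply: eq_bigr => s _; rewrite xy; congr (_ * (_ * _)).
by apply: IH => i j; rewrite !ffunE xy.
Qed.

Lemma wedge_pow_perm k (x : g ^ k.*2) (t : 'S_k.*2) :
  eta k [ffun i => x (t i)] = (-1) ^+ t * eta k x.
Proof.
case: k x t => [|k] x t.
  by rewrite (_ : t = 1%g) ?odd_perm1 ?mul1r //; apply/permP => -[].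
rewrite !wedge_powS mulrCA; congr (_ * _).
rewrite mulr_sumr [RHS](reindex_inj (mulIg t)) /=; apply: eq_bigr => s _.
have <- : (-1) ^+ t * (-1) ^+ (s * t)%g = (-1) ^+ s :> R.
  by rewrite odd_permM -signr_addb addbCA addbb addbF.
rewrite !ffunE !permM -mulrA; congr (_ * (_ * (_ * _))).
by congr (eta k _); apply/ffunP => i; rewrite !ffunE permM.
Qed.

Lemma wedge_pow_perp k (x : g ^ k.*2) i :
  (forall j, w (x i) (x j) = 0) -> (forall j, w (x j) (x i) = 0) -> eta k x = 0.
Proof.
elim: k x i => [|k IH] x i wl wr; first by case: i wl wr.
rewrite wedge_powS big1 ?mulr0 // => s _.
rewrite -[i](permKV s) in wl wr.
case: (splitP ((s^-1)%g i : 'I_(2 + k.*2))) => j ij.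
  case: j ij => -[|[|//]] j2 ij.
    have Ei : (s^-1)%g i = o0 _ by apply: val_inj.
    by rewrite -Ei wl mul0r mulr0.
  have Ei : (s^-1)%g i = o1 _ by apply: val_inj.
  by rewrite -Ei wr mul0r mulr0.
have Ei : (s^-1)%g i = rshift 2 j by apply: val_inj.
rewrite Ei in wl wr.
by rewrite (IH _ j) ?mulr0 // => l; rewrite !ffunE.
Qed.

Lemma wedge_pow_lin k (x y z : g ^ k.*2) i c :
  (forall u v t, w (c *: u + v) t = c * w u t + w v t) ->
  (forall u v t, w t (c *: u + v) = c * w t u + w t v) ->
  x i = c *: y i + z i -> (forall j, j != i -> x j = y j) ->
  (forall j, j != i -> x j = z j) -> eta k x = c * eta k y + eta k z.
Proof.
move=> wl wr; elim: k x y z i => [|k IH] x y z i xi xy xz; first by case: i xi xy xz.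
rewrite !wedge_powS mulrCA -mulrDr; congr (_ * _).
rewrite mulr_sumr -big_split /=.
apply: eq_bigr => s _ /=; rewrite [X in X + _]mulrCA -mulrDr; congr (_ * _).
have si j : j != (s^-1)%g i -> s j != i.
  by apply: contra => /eqP <-; rewrite permK.
rewrite -[i](permKV s) in xi.
have eE (u v : g ^ (2 + k.*2)) : (forall j, j != i -> u j = v j) ->
    (forall l, rshift 2 l != (s^-1)%g i) ->
    [ffun l => u (s (rshift 2 l))] = [ffun l => v (s (rshift 2 l))] :> g ^ k.*2.
  by move=> uv H; apply/ffunP => l; rewrite !ffunE uv ?si.
case: (splitP ((s^-1)%g i : 'I_(2 + k.*2))) => j ij.
  have H l : rshift 2 l != (s^-1)%g i.
    by apply/eqP => /(congr1 val) /=; have := ltn_ord j; rewrite ij; lia.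
  rewrite -(eE x y) // -(eE x z) //.
  case: j ij => -[|[|//]] j2 ij.
    have Ei : (s^-1)%g i = o0 _ by apply: val_inj.
    rewrite Ei in xi si; rewrite xi wl -(xy (s (o1 _))) ?si // -(xz (s (o1 _))) ?si //.
    by rewrite mulrDl mulrA.
  have Ei : (s^-1)%g i = o1 _ by apply: val_inj.
  rewrite Ei in xi si; rewrite xi wr -(xy (s (o0 _))) ?si // -(xz (s (o0 _))) ?si //.
  by rewrite mulrDl mulrA.
have Ei : (s^-1)%g i = rshift 2 j by apply: val_inj.
rewrite Ei in xi si.
rewrite -(xy (s (o0 _))) ?si // -(xz (s (o0 _))) ?si //.
rewrite -(xy (s (o1 _))) ?si // -(xz (s (o1 _))) ?si //.
rewrite mulrCA -mulrDr; congr (_ * _).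
by apply: (IH _ _ _ j) => [|l lj|l lj]; rewrite !ffunE //; [apply: xy|apply: xz];
  rewrite si // (inj_eq (@rshift_inj _ _)).
Qed.

(* The matrix of omega in an orthonormal basis x with x_(2j + 1) = J x_(2j). *)
Definition std_form (i j : nat) : R :=
  if i./2 == j./2 then (odd j)%:R - (odd i)%:R else 0.

(** Applied twice, this splits off the first two values of a permutation and leaves one of the
    remaining indices. *)
Lemma perm_lift n (s : 'S_n.+1) : exists t, s = lift_perm ord0 (s ord0) t.
Proof.
have nz j : s ord0 != s (lift ord0 j) by rewrite (inj_eq perm_inj) neq_lift.
pose f j := odflt j (unlift (s ord0) (s (lift ord0 j))).
have fE j : lift (s ord0) (f j) = s (lift ord0 j).
  by rewrite /f; have [k -> uE] := unlift_some (nz j); rewrite uE.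
have f_inj : injective f.
  by move=> j k /(congr1 (lift (s ord0))); rewrite !fE => /perm_inj/lift_inj.
exists (perm f_inj); apply/permP => j.
case: (unliftP ord0 j) => [k ->|->]; last by rewrite lift_perm_id.
by rewrite lift_perm_lift permE fE.
Qed.

(** For even p the double [bump] skips the pair p, p + 1, so the other pairs remain pairs and
    parities are kept. *)
Lemma std_form_bump p i j : ~~ odd p ->
  std_form (bump p (bump p i)) (bump p (bump p j)) = std_form i j.
Proof.
move=> op; rewrite /std_form.
have bE l : bump p (bump p l) = if (p <= l)%N then l.+2 else l.
  by rewrite /bump; case: leqP => pl /=; rewrite ?add1n ?add0n; case: leqP; lia.
have bo l : odd (bump p (bump p l)) = odd l by rewrite bE; case: ifP => //= _; rewrite negbK.
rewrite !bo; have -> // : ((bump p (bump p i))./2 == (bump p (bump p j))./2) = (i./2 == j./2).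
by rewrite !bE; case: ifP; case: ifP => *; apply/eqP/eqP; lia.
Qed.

Section Std.
Context k (x : g ^ (2 + k.*2)).
Hypothesis xE : forall i j, w (x i) (x j) = std_form i j.
Local Notation tail s := [ffun i => x (s (rshift 2 i))].

(** Let t be the permutation of the remaining indices. Splitting off the adjacent values p, p + 1
    contributes the sign (-1)^p twice, so s and t have the same sign, which also appears when t is
    undone in the tail. *)
Let eta_pair (s : 'S_(2 + k.*2)) : ~~ odd (s (o0 _)) ->
  s (o1 _) = (s (o0 _)).+1 :> nat ->
  (-1) ^+ s * eta k (tail s) = eta k [ffun i => x (rshift 2 i)].
Proof.
move=> op sp; have [t0 st0] := perm_lift (n := k.*2.+1) s.
have [t tt] := perm_lift t0; have o0E : o0 k.*2 = ord0 by apply: val_inj.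
have o1E : o1 k.*2 = lift ord0 ord0 by apply: val_inj.
move: op sp; rewrite o0E o1E; set p := (s ord0 : nat) => op.
rewrite st0 lift_perm_lift => t0p.
have {}t0p : t0 ord0 = p :> nat by move: t0p; rewrite /= /bump -/p; lia.
rewrite odd_lift_perm tt odd_lift_perm /= t0p -/p addbA addbb addFb.
pose y : g ^ k.*2 := [ffun l => x (lift (s ord0) (lift (t0 ord0) l))].
rewrite (_ : [ffun i => _] = [ffun l => y (t l)]); last first.
  apply/ffunP => l; rewrite !ffunE.
  rewrite (_ : rshift 2 l = lift ord0 (lift ord0 l)) ?lift_perm_lift //; exact: val_inj.
rewrite wedge_pow_perm mulrA -signr_addb addbb mul1r.
apply: wedge_pow_gram => i j; rewrite !ffunE !xE /= t0p -/p std_form_bump //.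
by rewrite /std_form !add2n /= !negbK eqSS.
Qed.

(* Up to a constant, omega^(n-1) is the Hodge dual of omega. *)
Lemma wedge_pow_std (s : 'S_(2 + k.*2)) :
  (-1) ^+ s * eta k (tail s) =
  eta k [ffun i => x (rshift 2 i)] * std_form (s (o0 _)) (s (o1 _)).
Proof.
have s01 : s (o0 _) != s (o1 _) by rewrite (inj_eq perm_inj).
have [E|nE] := eqVneq (s (o0 _))./2 (s (o1 _))./2; last first.
  rewrite /std_form (negPf nE) mulr0.
  (* The partner q of the first value of s occurs in the tail, but without its own partner; so x_q
     is omega-orthogonal to the whole tail. *)
  have [q qE qo] : exists2 q : 'I_(2 + k.*2), q./2 = (s (o0 _))./2 & odd q = ~~ odd (s (o0 _)).
    have : (nat_of_ord (s (o0 _)) < 2 + k.*2)%N by exact: ltn_ord.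
    move: (nat_of_ord _) => p pk.
    have qk : ((if odd p then p.-1 else p.+1) < 2 + k.*2)%N.
      by case: ifP => op; lia.
    by exists (Ordinal qk) => /=; case: ifP => op; lia.
  have q0 : q != s (o0 _) by apply/eqP => E; move: qo; rewrite E; case: odd.
  have q1 : q != s (o1 _) by apply/eqP => E; move: nE; rewrite -E qE eqxx.
  rewrite -[q](permKV s) in qE qo q0 q1.
  case: (splitP ((s^-1)%g q : 'I_(2 + k.*2))) => j ij.
    case: j ij => -[|[|//]] j2 ij.
      have Ei : (s^-1)%g q = o0 _ by apply: val_inj.
      by rewrite Ei eqxx in q0.
    have Ei : (s^-1)%g q = o1 _ by apply: val_inj.
    by rewrite Ei eqxx in q1.
  have Ei : (s^-1)%g q = rshift 2 j by apply: val_inj.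
  rewrite Ei in qE qo.
  have H l : ((s (rshift 2 l))./2 == (s (rshift 2 j))./2) ->
      odd (s (rshift 2 l)) = odd (s (rshift 2 j)).
    move=> /eqP hl; apply/eqP; apply/negPn/negP => ol.
    have /perm_inj/(congr1 val) : s (rshift 2 l) = s (o0 _) by apply: val_inj => /=; lia.
    by [].
  rewrite (wedge_pow_perp (i := j)) ?mulr0 // => l; rewrite !ffunE xE /std_form.
    by case: ifP => // hl; rewrite (H l) ?subrr // eq_sym.
  by case: ifP => // hl; rewrite (H l) ?subrr // eq_sym.
rewrite /std_form E eqxx.
have [o|o] := boolP (odd (s (o0 _))); last first.
  have s1 : s (o1 _) = (s (o0 _)).+1 :> nat.
    by move: s01; rewrite -val_eqE /=; lia.
  by rewrite eta_pair // s1 /= (negPf o) subr0 mulr1.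
have s0 : s (o0 _) = (s (o1 _)).+1 :> nat.
  by move: s01; rewrite -val_eqE /=; lia.
(* Exchanging the first two positions changes the sign and leads back to the case of an increasing
   pair. *)
pose s' := (tperm (o0 _) (o1 _) * s)%g.
have s'E : tail s' = tail s.
  by apply/ffunP => i; rewrite !ffunE permM tpermD.
have sg : (-1) ^+ s' = - (-1) ^+ s :> R.
  by rewrite odd_mul_tperm -val_eqE signr_addb expr1 mulN1r.
have o' : ~~ odd (s (o1 _)) by move: o; rewrite s0.
have := @eta_pair s'; rewrite s'E sg permM tpermL permM tpermR.
move=> /(_ o' s0) <-.
by rewrite (negPf o') sub0r mulrN1 mulNr opprK.
Qed.
End Std.

(** By [wedge_pow_std], each permutation contributes a square times the value on the tail, positive
    by induction; the square for the identity is 1. *)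
Lemma wedge_pow_std_gt0 k (x : g ^ k.*2) :
  (forall i j, w (x i) (x j) = std_form i j) -> 0 < eta k x.
Proof.
elim: k x => [|k IH] x xE; first exact: ltr01.
rewrite wedge_powS mulr_gt0 ?invr_gt0 ?ltr0n ?muln_gt0 ?fact_gt0 //.
pose y : g ^ k.*2 := [ffun i => x (rshift 2 i)].
have y0 : 0 < eta k y.
  by apply: IH => i j; rewrite !ffunE xE /std_form /= !negbK eqSS.
rewrite (eq_bigr (fun s : 'S_(2 + k.*2) => eta k y * std_form (s (o0 _)) (s (o1 _)) ^+ 2)).
  rewrite -mulr_sumr mulr_gt0 // (bigD1 1%g) //= !permE ltr_pwDl //.
    by rewrite /std_form /= subr0 expr1n.
  by apply: sumr_ge0 => s _; exact: sqr_ge0.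
move=> s _; rewrite mulrCA (wedge_pow_std xE) -/y xE; ring.
Qed.
End Forms.

Lemma std_formN (R : realType) i j : std_form i j = - std_form j i :> R.
Proof. by rewrite /std_form eq_sym; case: ifP => _; rewrite ?opprB ?oppr0. Qed.

Section RestExpansion.
Context {R : rcfType} {g : vectType R} (h : g -> g -> R) (hI : inner h).
Context n (x : 'I_n.+3 -> g) (xh : onb h x fullv).
Local Notation lift0 := (lift ord0).
Let q0 : 'I_n.+3 := ord0.
Let q1 : 'I_n.+3 := lift0 ord0.
Let q2 : 'I_n.+3 := lift0 (lift0 ord0).
Let q3 (l : 'I_n) : 'I_n.+3 := lift0 (lift0 (lift0 l)).

(* E stands for v |-> omega^(n-1) (v, x_(s 3), x_(s 4), ...). *)
Lemma rest_expansion (s : 'S_n.+3) (E : g -> R) (K : R) (F : 'I_n.+3 -> 'I_n.+3 -> R) v :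
  (forall i j, F i j = - F j i) ->
  (forall a u u', E (a *: u + u') = a * E u + E u') ->
  (forall s' : 'S_n.+3, (forall l, s' (q3 l) = s (q3 l)) ->
     (-1) ^+ s' * E (x (s' q2)) = K * F (s' q0) (s' q1)) ->
  (forall l, E (x (s (q3 l))) = 0) ->
  (-1) ^+ s * E v = K * (h v (x (s q2)) * F (s q0) (s q1)
    - h v (x (s q1)) * F (s q0) (s q2) + h v (x (s q0)) * F (s q1) (s q2)).
Proof.
move=> FN E_lin E_s E0; have E_0 : E 0 = 0.
  by have := E_lin (-1) 0 0; rewrite scaler0 addr0 mulN1r addNr.
have tw (p p' : 'I_n.+3) : p != p' -> (-1) ^+ (tperm p p' * s)%g = - (-1) ^+ s :> R.
  by move=> pp'; rewrite odd_mul_tperm pp' signr_addb expr1 mulN1r.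
have E2 : (-1) ^+ s * E (x (s q2)) = K * F (s q0) (s q1) by exact: E_s.
have E1 : (-1) ^+ s * E (x (s q1)) = - (K * F (s q0) (s q2)).
  have := E_s (tperm q1 q2 * s)%g.
  rewrite tw // permM tpermR permM tpermD // permM tpermL => <-.
    by rewrite mulNr opprK.
  by move=> l; rewrite permM tpermD.
have {}E3 : (-1) ^+ s * E (x (s q0)) = K * F (s q1) (s q2).
  have := E_s (tperm q0 q2 * s)%g.
  rewrite tw // permM tpermR permM tpermL permM tpermD // FN mulrN => H.
  by apply: oppr_inj; rewrite -H ?mulNr // => l; rewrite permM tpermD.
have hE p p' : h (x (s p)) (x (s p')) = (p == p')%:R.
  by rewrite (onb_dot xh) (inj_eq perm_inj).
move: (F _ _) (F _ _) (F _ _) E1 E2 E3 => A1 A2 A3 E1 E2 E3.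
elim/(onb_ind xh): v / (memvf v) => [|a u u' Hu Hu'|c].
- by rewrite E_0 !(inn0l hI) !mul0r !(subr0, addr0, mulr0).
- rewrite E_lin mulrDr mulrCA Hu Hu' !(innDl hI) !(innZl hI).
  move: (h _ _) (h _ _) (h _ _) (h _ _) (h _ _) (h _ _) => *; ring.
rewrite -[c](permKV s) !hE; move: ((s^-1)%g c) => {c} q.
case: (unliftP ord0 q) => [{}q ->|->]; last by rewrite E3 -!val_eqE /= !mul0r oppr0 !(add0r, mul1r).
case: (unliftP ord0 q) => [{}q ->|->]; last first.
  by rewrite E1 -!val_eqE /= !mul0r !(add0r, sub0r, addr0, mul1r) mulrN.
case: (unliftP ord0 q) => [{}q ->|->]; last first.
  by rewrite E2 -!val_eqE /= !mul0r !(subr0, addr0, mul1r).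
by rewrite E0 -!val_eqE /= !mul0r !(subr0, addr0, mulr0).
Qed.
End RestExpansion.

Section BalancedBasis.
Context {R : realType} {g : vectType R} (J : 'End(g)) (h : {dot g for idfun}).
Let hI := inner_dot h.
Let w u v := h (J u) v.
Local Notation eta k := (wedge_pow (fund_form J h) k).
Local Notation lift0 := (lift ord0).

Let aE (t : g ^ 2) : fund_form J h t = w (t ord0) (t ord_max). Proof. by []. Qed.

Section Rest.
Context n (x : g ^ n.+2.*2).
Hypothesis xh : onb h x fullv.
Hypothesis xw : forall i j, w (x i) (x j) = std_form i j.
Local Notation kap := (eta n.+1 [ffun i => x (rshift 2 i)]).
Let q0 : 'I_(n.+2.*2) := ord0.
Let q1 : 'I_(n.+2.*2) := lift0 ord0.
Let q2 : 'I_(n.+2.*2) := lift0 (lift0 ord0).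
Let q3 (l : 'I_(n.*2.+1)) : 'I_(n.+2.*2) := lift0 (lift0 (lift0 l)).

Definition rest (s : 'S_(n.+2.*2)) v : g ^ n.+1.*2 :=
  [ffun l => oapp (fun l' => x (s (q3 l'))) v (unlift ord0 l)].

Let tail_rest (s s' : 'S_(n.+2.*2)) : (forall l, s' (q3 l) = s (q3 l)) ->
  (-1) ^+ s' * eta n.+1 (rest s (x (s' q2))) = kap * std_form (s' q0) (s' q1).
Proof.
move=> ss'.
have := @wedge_pow_std _ _ _ _ aE n.+1 x xw s'.
have -> : lshift n.+1.*2 (@ord0 1) = q0 by apply: val_inj.
have -> : lshift n.+1.*2 (@ord_max 1) = q1 by apply: val_inj.
move=> <-; congr (_ * eta _ _); apply/ffunP => l; rewrite !ffunE.
case: unliftP => [l' ->|->] /=; first by rewrite -ss'; congr (x (s' _)); apply: val_inj.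
by congr (x (s' _)); apply: val_inj.
Qed.

Lemma eta_rest (s : 'S_(n.+2.*2)) v : (-1) ^+ s * eta n.+1 (rest s v) =
  kap * (h v (x (s q2)) * std_form (s q0) (s q1)
         - h v (x (s q1)) * std_form (s q0) (s q2)
         + h v (x (s q0)) * std_form (s q1) (s q2)).
Proof.
apply: (rest_expansion hI xh (E := fun v => eta n.+1 (rest s v)) (F := std_form)).
- by move=> i j; apply: std_formN.
- move=> a u u'.
  apply: (wedge_pow_lin aE (k := n.+1) (i := ord0 : 'I_(n.+1.*2))).
  - by move=> u1 u2 t; rewrite /w linearD linearZ (innDl hI) (innZl hI).
  - by move=> u1 u2 t; rewrite /w (innDr hI) (innZr hI).
  - by rewrite !ffunE unlift_none.
  - by move=> l; rewrite !ffunE; case: unliftP => [l' ->|->]; rewrite ?eqxx.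
  - by move=> l; rewrite !ffunE; case: unliftP => [l' ->|->]; rewrite ?eqxx.
- exact: tail_rest.
(* The argument is repeated; transposing the two equal entries changes the sign of the value. *)
move=> q; pose t : 'S_(n.+1.*2) := tperm ord0 (lift0 q).
have := @wedge_pow_perm _ _ _ _ aE n.+1 (rest s (x (s (q3 q)))) t.
rewrite (_ : [ffun i => _] = rest s (x (s (q3 q)))).
  by rewrite odd_tperm; move: (eta _ _) => E; rewrite /= expr1 mulN1r => H; lra.
apply/ffunP => l; rewrite !ffunE /t; case: tpermP => [->|->|//].
  by rewrite liftK unlift_none.
by rewrite liftK unlift_none.
Qed.
End Rest.
End BalancedBasis.

Section Contraction.
Context {R : realFieldType} n (C : 'I_n.+1 -> 'I_n.+1 -> 'I_n.+1 -> R).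
Context (F : 'I_n.+1 -> 'I_n.+1 -> R).
Hypotheses (CN : forall l i j, C l i j = - C l j i) (FN : forall i j, F i j = - F j i).

(* If C are the structure constants of a basis x and F is the matrix of omega, the
   terms of d(omega^(n-1)) at the vectors of x other than x_m are multiples of
   the cyclic_term m i j with i < j. *)
Definition cyclic_term m i j := C j i j * F m i - C i i j * F m j + C m i j * F i j.

(** The cyclic term is symmetric in i and j, and vanishes if i = j or if one of them is m. So the
    sum over all i and j is twice the given one, and there two of the three terms drop out by the
    trace condition. *)
Lemma cyclic_term_sum m : (forall i, \sum_j C j i j = 0) ->
  \sum_(i < n) \sum_(j < n | (i < j)%N) cyclic_term m (lift m i) (lift m j) = 0 ->
  \sum_i \sum_j C m i j * F i j = 0.
Proof.
move=> C0; set T := cyclic_term m => T0.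
have TC i j : T i j = T j i.
  by rewrite /T /cyclic_term (CN j i j) (CN i i j) (CN m i j) (FN i j); ring.
have Tm i : T i m = 0.
  have F0 : F m m = 0 by have := FN m m; lra.
  by rewrite /T /cyclic_term F0 (FN i m); ring.
have Tii i : T i i = 0.
  have C00 l : C l i i = 0 by have := CN l i i; lra.
  by rewrite /T /cyclic_term !C00; ring.
have Tlt : \sum_(i < n) \sum_(j < n | (j < i)%N) T (lift m i) (lift m j) = 0.
  rewrite (exchange_big_dep xpredT) //= -[RHS]T0; apply: eq_bigr => j _.
  by apply: eq_bigr => i _; rewrite TC.
have : \sum_i \sum_j T i j = 0.
  rewrite (bigD1_ord m) //= big1 ?add0r => [|j _]; last by rewrite TC Tm.
  rewrite -[RHS](addr0 0) -[X in _ = X + _]T0 -[X in _ = _ + X]Tlt -big_split.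
  apply: eq_bigr => i _ /=.
  rewrite (bigD1_ord m) //= Tm add0r (bigID (fun j : 'I_n => (i < j)%N)) /=; congr (_ + _).
  rewrite (bigD1 i) ?ltnn //= Tii add0r; apply: eq_bigl => j.
  by rewrite -leqNgt andbC ltn_neqAle.
rewrite /T /cyclic_term; under eq_bigr => i _ do rewrite big_split sumrB /=.
rewrite big_split sumrB /= big1 => [|i _]; last by rewrite -mulr_suml C0 mul0r.
rewrite exchange_big /= big1 ?subr0 ?add0r // => j _.
rewrite -mulr_suml (eq_bigr (fun i => - C i j i)) => [|i _]; last exact: CN.
by rewrite sumrN C0 oppr0 mul0r.
Qed.
End Contraction.

Section BalancedSum.
Context {R : realType} {g : vectType R} (br : {bilinear g -> g -> g}).
Context (J : 'End(g)) (h : {dot g for idfun}).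
Hypothesis (CL : complex_lie br J).
Let hI := inner_dot h.
Let B := cl_bilin CL.

Definition structure_constants n (x : 'I_n -> g) l i j : R := h (br (x i) (x j)) (x l).

Section Terms.
Context n (x : g ^ n.+2.*2).
Hypothesis xh : onb h x fullv.
Hypothesis xw : forall i j, h (J (x i)) (x j) = std_form i j.
Local Notation kap := (wedge_pow (fund_form J h) n.+1 [ffun i => x (rshift 2 i)]).

(* The sequence m, lift m i, lift m (lift i j) followed by all other indices in
   increasing order. *)
Definition tri_perm (m : 'I_(n.+2.*2)) (i : 'I_(n.+1.*2.+1)) (j : 'I_(n.+1.*2)) : 'S_(n.+2.*2) :=
  lift_perm ord0 m (lift_perm ord0 i (lift_perm ord0 j 1)).

Definition omit (m : 'I_(n.+2.*2)) : g ^ n.+1.*2.+1 := [ffun i => x (lift m i)].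

Lemma ce_args_tri m (i : 'I_(n.+1.*2.+1)) (j : 'I_(n.+1.*2)) : (i <= j)%N ->
  ce_args br (omit m) i (lift i j) =
  rest x (tri_perm m i j) (br (x (lift m i)) (x (lift m (lift i j)))).
Proof.
move=> ij; apply/ffunP => l; rewrite !ffunE.
case: (unliftP ord0 l) => [l' ->|->] //=.
rewrite /tri_perm !lift_perm_lift perm1; congr (x (lift m _)); apply: val_inj => /=.
have l'n : (l' < n.*2.+1)%N := ltn_ord l'.
have lt : (bump (bump i j) (bump i l') < n.+1.*2.+1)%N by rewrite /bump; lia.
rewrite add0n (inordK lt).
by rewrite [RHS]bumpC /unbump ltnNge ij subn0.
Qed.

Lemma ce_term_tri m (i : 'I_(n.+1.*2.+1)) (j : 'I_(n.+1.*2)) : (i <= j)%N ->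
  (-1) ^+ (i + lift i j) * wedge_pow (fund_form J h) n.+1 (ce_args br (omit m) i (lift i j)) =
  - (-1) ^+ m * kap *
  cyclic_term (structure_constants x) (fun a b => std_form a b) m (lift m i) (lift m (lift i j)).
Proof.
(* As i <= j, the value of [lift i j] is j + 1, whence the minus sign. *)
move=> ij; have sg : (-1) ^+ (i + lift i j) = - (-1) ^+ m * (-1) ^+ (tri_perm m i j) :> R.
  rewrite /tri_perm !odd_lift_perm odd_perm1 -[LHS]signr_odd -[X in - X * _]signr_odd.
  rewrite /= /bump ij add1n oddD /=.
  by case: (odd m); case: (odd i); case: (odd j); rewrite /= ?expr0 ?expr1; ring.
rewrite (ce_args_tri m ij) sg -mulrA (eta_rest xh xw).
by rewrite /tri_perm !(lift_perm_lift, lift_perm_id) -mulrA.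
Qed.

(** The differential is evaluated on all basis vectors except x_m; the common factor is nonzero by
    [wedge_pow_std_gt0] and can be cancelled. *)
Lemma balanced_cyclic m : (forall y, ce_diff br (wedge_pow (fund_form J h) n.+1) y = 0) ->
  \sum_(i < n.+1.*2.+1) \sum_(j < n.+1.*2.+1 | (i < j)%N)
    cyclic_term (structure_constants x) (fun a b => std_form a b) m (lift m i) (lift m j) = 0.
Proof.
move=> bal; have kap0 : - (-1) ^+ m * kap != 0.
  rewrite mulf_neq0 ?oppr_eq0 ?signr_eq0 // gt_eqF //.
  apply: (wedge_pow_std_gt0 (w := fun u => h (J u))) => // i j.
  by rewrite !ffunE xw /std_form /= !negbK eqSS.
apply: (mulfI kap0); rewrite mulr0 -[RHS](bal (omit m)) /ce_diff mulr_sumr.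
apply: eq_bigr => i _; rewrite mulr_sumr; apply: eq_bigr => j ij.
have [j' jE] : exists j' : 'I_(n.+1.*2), j = lift i j'.
  by case: (unliftP i j) ij => [j' ->|->]; [exists j'|rewrite ltnn].
have ij' : (i <= j')%N by move: ij; rewrite jE /= /bump; case: leqP => //; lia.
by rewrite jE ce_term_tri.
Qed.
End Terms.

Lemma balanced_sum k (x : g ^ k.+1.*2) : onb h x fullv ->
  (forall i j, h (J (x i)) (x j) = std_form i j) ->
  (forall y, ce_diff br (wedge_pow (fund_form J h) k) y = 0) ->
  (forall i, \sum_j structure_constants x j i j = 0) ->
  \sum_i br (x i) (J (x i)) = 0.
Proof.
move=> xh xw bal tr0; set S := \sum_i _.
suff S0 m : h S (x m) = 0.
  by rewrite (onb_exp xh (memvf S)) big1 // => m _; rewrite S0 scale0r.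
pose F (a b : 'I_k.*2.+2) : R := std_form a b.
have CF0 : \sum_i \sum_j structure_constants x m i j * F i j = 0; last first.
  rewrite -[RHS]CF0 /S (inn_suml hI); apply: eq_bigr => i _.
  rewrite {1}(onb_exp xh (memvf (J (x i)))) (bil_sumr B) (inn_suml hI).
  by apply: eq_bigr => j _; rewrite (bilZr B) (innZl hI) xw mulrC.
apply: cyclic_term_sum => //.
- by move=> l i j; rewrite /structure_constants (brC CL) (innNl hI).
- by move=> i j; apply: std_formN.
case: k x xh xw bal tr0 @F {S} m => [|n] x xh xw bal tr0 F m; last exact: balanced_cyclic.
(* In real dimension 2 there is no pair i < j, and the sum is empty. *)
by rewrite big_ord1 big1 // => j; rewrite (ord1 j) ltnn.
Qed.

End BalancedSum.

(** * Traces and orthonormal bases adapted to J *)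

Section AdaptedBasis.
Context {R : realType} {g : vectType R} (h : g -> g -> R) (hI : inner h).

Lemma onb_dim n (x : 'I_n -> g) U : onb h x U -> \dim U = n.
Proof.
move=> xh; pose X := [tuple x i | i < n].
have XE (i : 'I_n) : X`_i = x i by rewrite -tnth_nth tnth_mktuple.
have : basis_of U X.
  apply/andP; split.
    apply/eqP/subv_anti/andP; split.
      by apply/span_subvP => _ /mapP[i _ ->]; apply: onb_mem xh i.
    apply/subvP => u uU; rewrite (onb_exp xh uU); apply: memv_suml => i _.
    by rewrite memvZ // memv_span // -(XE i) mem_nth // size_tuple.
  apply/freeP => k k0 i; have := congr1 (h^~ (x i)) k0.
  rewrite /= (inn0l hI) (inn_suml hI) (bigD1 i) //= big1 => [|j ji].
    by rewrite addr0 XE (innZl hI) (onb_dot xh) eqxx mulr1.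
  by rewrite XE (innZl hI) (onb_dot xh) (negPf ji) mulr0.
by move/size_basis.
Qed.

Lemma trace_onb n (x : 'I_n -> g) (f : 'End(g)) : onb h x fullv ->
  lfun_trace f = \sum_i h (f (x i)) (x i).
Proof.
move=> xh; rewrite /lfun_trace /mxtrace; set b := vbasis _.
have bE v : v = \sum_i coord b i v *: b`_i by rewrite {1}(coord_vbasis (memvf v)).
transitivity (\sum_(i < \dim {:g}) coord b i (f b`_i)).
  by apply: eq_bigr => i _; rewrite !mxE /= passmx.vecof_delta.
transitivity (\sum_(i < \dim {:g}) \sum_j h b`_i (x j) * coord b i (f (x j))).
  apply: eq_bigr => i _; rewrite {1}(onb_exp xh (memvf b`_i)) !linear_sum.
  by apply: eq_bigr => j _; rewrite !linearZ.
rewrite exchange_big; apply: eq_bigr => j _ /=.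
rewrite [X in h X _](bE (f (x j))) (inn_suml hI).
by apply: eq_bigr => i _; rewrite (innZl hI) mulrC.
Qed.

(** For a unit vector v, the pair v, Jv is orthonormal, and its orthogonal complement in [U] is
    again J-stable. *)
Lemma adapted_onb (J : 'End(g)) (U : {vspace g}) : (forall x, J (J x) = - x) ->
  (forall x y, h (J x) (J y) = h x y) -> (forall x, x \in U -> J x \in U) ->
  exists k (x : 'I_k.*2 -> g), onb h x U /\ forall i j, h (J (x i)) (x j) = std_form i j.
Proof.
move=> JJ hJ; have hJr u v : h u (J v) = - h (J u) v by rewrite -hJ JJ (innNr hI).
move: {2}(\dim U).+1 (ltnSn (\dim U)) => n; elim: n U => // n IH U.
rewrite ltnS => dU JU; case: (eqVneq U 0%VS) => [->|U0].
  exists 0%N, (fun=> 0); split=> [|[]//]; split=> [[]//|[]//|u].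
  by rewrite memv0 big_ord0 => /eqP.
have [v vU hv] := unit_vector hI U0.
have hJv : h (J v) (J v) = 1 by rewrite hJ.
have hvJ : h (J v) v = 0 by have := hJr v v; rewrite (innC hI v); lra.
have nz u : h u u = 1 -> u != 0.
  by move=> hu; apply/eqP => u0; move: hu; rewrite u0 (inn0l hI); lra.
have v0 := nz _ hv; have Jv0 := nz _ hJv.
pose U' := (U :&: perp h v :&: perp h (J v))%VS.
have U'P u : u \in U' = [&& u \in U, h u v == 0 & h u (J v) == 0].
  by rewrite !memv_cap !(perpP hI) // andbA.
have dU' : (\dim U' < n)%N.
  apply: leq_trans dU; rewrite ltn_neqAle dimvS ?andbT; last first.
    by apply/subvP => u; rewrite U'P => /andP[].
  apply/negP => /eqP dE; have /eqP UE : U' == U.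
    by rewrite eqEdim dE leqnn andbT; apply/subvP => u; rewrite U'P => /andP[].
  by move: vU; rewrite -UE U'P hv oner_eq0 andbF.
have [|k [X [xh xw]]] := IH _ dU'.
  by move=> u; rewrite !U'P hJ -[h (J u) v]opprK -hJr oppr_eq0 => /and3P[/JU-> -> ->].
have XP j : h (X j) v = 0 /\ h (X j) (J v) = 0.
  by have := onb_mem xh j; rewrite U'P => /and3P[_ /eqP-> /eqP->].
have Xv j := (XP j).1; have XJv j := (XP j).2; have vX j : h v (X j) = 0 by rewrite (innC hI).
have JvX j : h (J v) (X j) = 0 by rewrite (innC hI).
have hvJ' : h v (J v) = 0 by rewrite (innC hI).
pose y (i : 'I_(k.+1.*2)) :=
  oapp (fun i' => oapp X (J v) (unlift ord0 i')) v (unlift ord0 i).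
exists k.+1, y; split; first split.
- move=> i; rewrite /y; case: unliftP => [{}i _|] //=; case: unliftP => [{}i _|_] /=.
    by have := onb_mem xh i; rewrite U'P => /and3P[].
  exact: JU.
- move=> i j; rewrite /y; case: (unliftP ord0 i) => [{}i ->|->] /=;
    case: (unliftP ord0 j) => [{}j ->|->] //=.
  + rewrite (inj_eq lift_inj); case: (unliftP ord0 i) => [{}i ->|->] /=;
    case: (unliftP ord0 j) => [{}j ->|->] //=.
    by rewrite (onb_dot xh) (inj_eq lift_inj).
  + by case: (unliftP ord0 i) => [{}i _|_] /=.
  + by case: (unliftP ord0 j) => [{}j _|_] /=.
- move=> u uU; rewrite big_ord_recl big_ord_recl /y !unlift_none !liftK /= unlift_none /=.
  under eq_bigr => i _ do rewrite !liftK /=.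
  pose u' := u - h u v *: v - h u (J v) *: J v.
  have u'U : u' \in U'.
    rewrite U'P !rpredB ?memvZ ?JU //= !(innBl hI) !(innZl hI) hv hJv hvJ hvJ'.
    by rewrite !(mulr0, mulr1, subr0) !subrr eqxx.
  have uE : u = h u v *: v + (h u (J v) *: J v + u').
    by rewrite /u' [h u (J v) *: _ + _]addrC subrK addrC subrK.
  rewrite {1}uE; congr (_ + (_ + _)); rewrite {1}(onb_exp xh u'U).
  apply: eq_bigr => i _.
  by rewrite liftK /= !(innBl hI) !(innZl hI) vX JvX !mulr0 !subr0.
move=> i j; rewrite /y; case: (unliftP ord0 i) => [{}i ->|->] /=;
  case: (unliftP ord0 j) => [{}j ->|->] //=.
- case: (unliftP ord0 i) => [{}i ->|->] /=; case: (unliftP ord0 j) => [{}j ->|->] //=.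
  + by rewrite xw /std_form /= !negbK eqSS.
  + by rewrite hJ Xv.
  + by rewrite JJ (innNl hI) vX oppr0.
  + by rewrite JJ (innNl hI) hvJ' oppr0 /std_form /= subrr.
- case: (unliftP ord0 i) => [{}i ->|->] /=; last by rewrite JJ (innNl hI) hv /std_form /= sub0r.
  by rewrite -[h _ _]opprK -hJr XJv oppr0.
- case: (unliftP ord0 j) => [{}j ->|->] /=; first by rewrite JvX.
  by rewrite hJv /std_form /= subr0.
- by rewrite hvJ /std_form /= subrr.
Qed.
End AdaptedBasis.

(** * The Kahler metric *)

Section Final.
Context {R : realType} {g : vectType R}.

Lemma inner_is_dot (h : g -> g -> R) : inner h ->
  exists h' : {dot g for idfun}, forall x y, h' x y = h x y.
Proof.
move=> hI.
pose hB := isBilinear.Build R g g R *%R (idfun \; *%R) h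
  (fun z x y => innBl hI x y z) (fun z x y => innBr hI x y z)
  (fun z k x => innZl hI k x z) (fun z k x => innZr hI k x z).
have hh x y : h x y = (-1) ^+ false * idfun (h y x) by rewrite expr0 mul1r (innC hI).
have hp x : x != 0 -> 0 < h x x by have [_ _] := hI; apply.
pose D : {dot g for (idfun : R -> R)} := HB.pack h hB
  (isHermitianSesquilinear.Build R g false idfun h hh) (isDotProduct.Build R g h hp).
by exists D.
Qed.

Lemma balanced_family (br : {bilinear g -> g -> g}) (J : 'End(g)) (h : {dot g for idfun}) :
  complex_lie br J -> unimodular br -> J_compatible J h -> balanced br J h ->
  exists n (e : 'I_n -> g), \sum_i sb br J (e i) (e i) = 0 /\
    forall U : {vspace g}, (forall i, e i \in U) -> U = fullv.
Proof.
move=> CL uni hJ; have hI := inner_dot h.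
have [|k [x [xh xw]]] := @adapted_onb _ _ _ hI J fullv (cl_JJ CL) hJ.
  by move=> *; exact: memvf.
rewrite /balanced (onb_dim hI xh) doubleK => bal.
exists k.*2, x; split; last first.
  move=> U xU; apply/eqP; rewrite eqEsubv subvf; apply/subvP => u _.
  by rewrite (onb_exp xh (memvf u)); apply: memv_suml => i _; apply: memvZ.
rewrite (eq_bigr (fun i => - J (br (x i) (J (x i))))) => [|i _]; last exact: sb_self.
rewrite sumrN -linear_sum; apply/eqP; rewrite oppr_eq0; apply/eqP.
case: k x xh xw bal => [|k] x xh xw bal; first by rewrite big_ord0 linear0.
pose y : g ^ k.+1.*2 := [ffun i => x i].
have yx : y =1 x by move=> i; rewrite ffunE.
have := @balanced_sum _ _ br J h CL k y.
rewrite (eq_bigr (fun i => br (x i) (J (x i)))) => [|i _]; last by rewrite !yx.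
move=> -> //; first exact: linear0.
- by split=> [i|i j|u uU]; rewrite ?yx ?(onb_dot xh) ?memvf // {1}(onb_exp xh uU);
    apply: eq_bigr => i _; rewrite yx.
- by move=> i j; rewrite !yx.
move=> i; rewrite -[RHS](uni (x i)) (trace_onb hI _ xh); apply: eq_bigr => j _.
by rewrite /structure_constants !yx /ad lfunE.
Qed.

(** On [a], ad u is skew and commutes with J, so J ad u is symmetric there; this is [key]. As W and
    [a] are abelian, d omega only involves brackets of W with [a], and its six terms cancel in
    pairs. *)
Lemma flat_kahler (br : {bilinear g -> g -> g}) (J : 'End(g)) (h : g -> g -> R) (W a : {vspace g}) :
  complex_lie br J -> inner h -> (forall x y, h (J x) (J y) = h x y) ->
  (forall x y, br x y \in a) -> (forall x, x \in a -> J x \in a) ->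
  (forall x y, x \in a -> y \in a -> br x y = 0) ->
  (forall x y, y \in a -> br x (J y) = J (br x y)) ->
  (forall x y y', y \in a -> y' \in a -> h (br x y) y' = - h y (br x y')) ->
  (W + a = fullv)%VS -> (W :&: a = 0)%VS -> (forall x, x \in W -> J x \in W) ->
  (forall x y, x \in W -> y \in W -> br x y = 0) ->
  exists h' : {dot g for idfun}, J_compatible J h' /\ kahler br J h'.
Proof.
move=> CL hI hJ br_a Ja aa brJ skew Wa Wa0 JW WW.
have B := cl_bilin CL; have JJ := cl_JJ CL.
pose p := daddv_pi a W; pose q := daddv_pi W a.
have aW0 : (a :&: W = 0)%VS by rewrite capvC.
have pa x : p x \in a by exact: memv_pi.
have qW x : q x \in W by exact: memv_pi.
have pq x : x = p x + q x.
  by rewrite [RHS]addrC daddv_pi_add ?Wa ?memvf.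
have p_id x : x \in a -> p x = x by exact: daddv_pi_id.
have q_id x : x \in W -> q x = x by exact: daddv_pi_id.
have q_a x : x \in a -> q x = 0.
  by move=> xa; have := pq x; rewrite p_id // -{1}[x]addr0 => /addrI.
have p_W x : x \in W -> p x = 0.
  by move=> xW; have := pq x; rewrite q_id // -{1}[x]add0r => /addIr.
have lD (f : 'End(g)) u v : f (u + v) = f u + f v by exact: linearD.
have pJ x : p (J x) = J (p x).
  rewrite {1}(pq x) (lD J) (lD p) (p_id _ (Ja _ (pa x))).
  by rewrite (p_W _ (JW _ (qW x))) addr0.
have qJ x : q (J x) = J (q x).
  rewrite {1}(pq x) (lD J) (lD q) (q_a _ (Ja _ (pa x))).
  by rewrite (q_id _ (JW _ (qW x))) add0r.
pose h0 x y := h (p x) (p y) + h (q x) (q y).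
have h0I : inner h0.
  split=> [k x y z|x y|x x0]; rewrite /h0.
  - by rewrite !linearD !linearZ !(innDl hI) !(innZl hI); ring.
  - by rewrite (innC hI (p x)) (innC hI (q x)).
  have [px|px] := eqVneq (p x) 0.
    rewrite px (inn0l hI) add0r; have [_ _] := hI; apply.
    by apply: contra_neq x0 => qx; rewrite (pq x) px qx addr0.
  by rewrite ltr_pwDl ?(inn_ge0 hI) //; have [_ _] := hI; apply.
have [h' h'E] := inner_is_dot h0I.
exists h'; split=> [x y|t]; first by rewrite !h'E /h0 !pJ !qJ !hJ.
have -> : t = tup 3 [:: t ord0; t (inord 1); t ord_max].
  apply/ffunP => i; rewrite !ffunE.
  case: i => -[|[|[|//]]] /= lti; congr (t _); apply/val_inj => //=.
  by rewrite inordK.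
rewrite (@ce_diff2 _ _ _ (fun u v => h' (J u) v)) //.
move: (t _) (t _) (t _) => x y z; rewrite !h'E.
have A u v : h0 (J u) v = h (J (p u)) (p v) + h (J (q u)) (q v) by rewrite /h0 pJ qJ.
have brE u v : br u v = br (q u) (p v) - br (q v) (p u).
  rewrite {1}(pq u) {1}(pq v) !(bilDl B) !(bilDr B) (aa _ _ (pa u) (pa v)) (WW _ _ (qW u) (qW v)).
  by rewrite add0r addr0 addrC (brC CL (p u)).
have key u v v' : v \in a -> v' \in a -> h (J (br u v)) v' = h (J (br u v')) v.
  move=> va v'a; have hJr s s' : h s (J s') = - h (J s) s' by rewrite -hJ JJ (innNr hI).
  by rewrite -brJ // skew ?Ja // -hJr (innC hI).
have h0E u v w : h0 (J (br u v)) w =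
    h (J (br (q u) (p v))) (p w) - h (J (br (q v) (p u))) (p w).
  by rewrite A p_id // q_a // linear0 (inn0l hI) addr0 brE linearB (innBl hI).
rewrite !h0E (key (q x) (p y)) // (key (q y) (p x)) // (key (q z) (p x)) //.
ring.
Qed.
End Final.

Theorem theorem3 (R : realType) (g : vectType R)
    (br : {bilinear g -> g -> g}) (J : 'End(g)) :
  lie_bracket br -> two_step_solvable br -> unimodular br ->
  complex_structure br J ->
  (exists h : {dot g for idfun}, J_compatible J h /\ skt br J h) ->
  (exists h : {dot g for idfun}, J_compatible J h /\ balanced br J h) ->
  J_solvable br J /\
  (exists h : {dot g for idfun}, J_compatible J h /\ kahler br J h).
Proof.
move=> lie st uni cs [h [hJ hskt]] [h2 [h2J bal]].
have CL := complex_lie_of lie st cs.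
have [n [e [e0 e_span]]] := balanced_family CL uni h2J bal.
have hI := inner_dot h.
have SB : skt_balanced br J h e.
  by split=> // x y; apply: skt_form_skt.
have [Ja brJ skew [W [Wa Wa0 JW WW]]] := flat_splitting SB (adJ_zero SB).
have aa x y : x \in lie_der br -> y \in lie_der br -> br x y = 0.
  by move=> xa ya; exact: (br_der0 CL xa ya).
split; last exact: (flat_kahler CL hI hJ (mem_br CL) Ja aa brJ skew Wa Wa0 JW WW).
(* The first term of the series lies in a + Ja = a, and [a, a] = 0. *)
exists 2%N; apply/eqP; rewrite -subv0 /=.
have a1 : (J_derived br J 1 <= lie_der br)%VS.
  rewrite /= subv_add subvv; apply/subvP => _ /memv_imgP[x xa ->]; exact: Ja.
have b0 : (bracketv br (J_derived br J 1) (J_derived br J 1) <= 0)%VS.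
  apply/bracketvP => u v /(subvP a1) ua /(subvP a1) va.
  by rewrite memv0 aa.
by rewrite subv_add b0; apply: subv_trans (limgS J b0) _; rewrite limg0.
Qed.
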